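(* Let $\delta=1-(1+\log\log 2)/\log 2\approx 0.086$. Let $q$ be a prime power and let $1\le k\le n/2$ be integers. (1) For $a\in\mathbf F_q^\times$, \[H_a(n,k)\ll q^{n-1}k^{-\delta}(1+\log k)^{-1/2}.\] (2) For $a=\pm1$, \[H^*_a(n,k)\ll|\mathcal P^*_a(n)|\,k^{-\delta}(1+\log k)^{-1/2}.\] (3) If $q$ is a square, then for $a\in U$, \[H^\dagger_a(n,k)\ll q^{(n-1)/2}k^{-\delta}(1+\log k)^{-1/2}.\]
   Context: $X\ll Y$ means $X\le CY$ for an absolute constant $C$. All polynomials are monic over $\mathbf F_q$. For $f(X)=X^n+a_{n-1}X^{n-1}+\cdots+a_0$ with $a_0\ne0$, let $f^*(X)=X^nf(1/X)/f(0)$; $f$ is $*$-symmetric if $f^*=f$. If $q$ is a square, let $\bar x=x^{q^{1/2}}$ for $x\in\mathbf F_q$, let $\bar f$ be $f$ with this map applied to its coefficients, and let $f^\dagger(X)=X^n\bar f(1/X)/\bar f(0)$; $f$ is $\dagger$-symmetric if $f^\dagger=f$. $U\le\mathbf F_q^\times$ is the cyclic subgroup of order $q^{1/2}+1$. $\mathcal P_a(n)$ is the set of monic polynomials of degree $n$ over $\mathbf F_q$ with $f(0)=a$ ($a\in\mathbf F_q$). $\mathcal P^*_a(n)$ is the set of $*$-symmetric monic polynomials of degree $n$ with $f(0)=a$ ($a=\pm1$). $\mathcal P^\dagger_a(n)$ is the set of $\dagger$-symmetric monic polynomials of degree $n$ with $f(0)=a$ ($a\in U$). $H_a(n,k)$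 is the number of $f\in\mathcal P_a(n)$ having a factor of degree $k$; $H^*_a(n,k)$ is the number of $f\in\mathcal P^*_a(n)$ having a $*$-symmetric factor of degree $k$; $H^\dagger_a(n,k)$ is the number of $f\in\mathcal P^\dagger_a(n)$ having a $\dagger$-symmetric factor of degree $k$. *)

(* Defs.v *)
From HB Require Import structures.
From mathcomp Require Import all_boot all_order all_algebra all_fingroup.
From mathcomp Require Import reals exp.

Set Implicit Arguments.
Unset Strict Implicit.
Unset Printing Implicit Defensive.

Import Order.TTheory GRing.Theory Num.Theory.
Local Open Scope ring_scope.

Section Polynomials.
Variable F : finFieldType.

Definition monic_of_degree (n : nat) (f : {poly F}) : bool :=
  (f \is monic) && (size f == n.+1).

(* X^n f(1/X), where n is the degree of f *)
Definition reversed (f : {poly F}) : {poly F} :=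
  \poly_(i < size f) f`_((size f).-1 - i).

Definition star (f : {poly F}) : {poly F} := f.[0]^-1 *: reversed f.

Definition star_symmetric (f : {poly F}) : bool :=
  (f.[0] != 0) && (star f == f).

(* In what follows r stands for q^{1/2}, i.e. #|F| = r ^ 2. *)
Definition bar (r : nat) (f : {poly F}) : {poly F} :=
  map_poly (fun x : F => x ^+ r) f.

Definition dagger (r : nat) (f : {poly F}) : {poly F} :=
  (bar r f).[0]^-1 *: reversed (bar r f).

Definition dagger_symmetric (r : nat) (f : {poly F}) : bool :=
  (f.[0] != 0) && (dagger r f == f).

(* The polynomials of degree n are collected inside the finite type
   {poly_n.+1 F} of polynomials of size at most n.+1. *)
Definition Pol (a : F) (n : nat) : {set {poly_n.+1 F}} :=
  [set f : {poly_n.+1 F} | monic_of_degree n f & f.[0] == a].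

Definition PolStar (a : F) (n : nat) : {set {poly_n.+1 F}} :=
  [set f in Pol a n | star_symmetric f].

Definition PolDagger (r : nat) (a : F) (n : nat) : {set {poly_n.+1 F}} :=
  [set f in Pol a n | dagger_symmetric r f].

Definition H (a : F) (n k : nat) : nat :=
  #|[set f in Pol a n |
      [exists g : {poly_k.+1 F}, monic_of_degree k g && (g %| f)]]|.

Definition HStar (a : F) (n k : nat) : nat :=
  #|[set f in PolStar a n |
      [exists g : {poly_k.+1 F},
        [&& monic_of_degree k g, star_symmetric g & g %| f]]]|.

Definition HDagger (r : nat) (a : F) (n k : nat) : nat :=
  #|[set f in PolDagger r a n |
      [exists g : {poly_k.+1 F},
        [&& monic_of_degree k g, dagger_symmetric r g & g %| f]]]|.

End Polynomials.

Definition delta (R : realType) : R := 1 - (1 + ln (ln 2)) / ln 2.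

Definition decay (R : realType) (k : nat) : R :=
  k%:R `^ (- delta R) * (1 + ln k%:R) `^ (- (1 / 2)).

(* Main.v *)
Require Import Defs.
From HB Require Import structures.
From mathcomp Require Import all_boot all_order all_algebra all_fingroup.
From mathcomp Require Import reals exp.
From mathcomp Require Import all_solvable all_field sequences.
From mathcomp Require Import ring lra zify.

(** Let Omega f be the number of prime factors of f of degree at most K, counted
    with multiplicity, and put L = log K. For a random f this is close to a
    Poisson variable of mean L. Let m be the integer part of log K / log 2, and
    let f = g h with deg g = k, where K is at most the degrees of g and h.

    Either Omega f > m. This has probability about e^(-L) L^m / m!, because the
    tail of the Poisson distribution beyond m > L decreases geometrically. Or
    Omega g + Omega h <= m. The expected number of such pairs (g, h) is about the
    sum over s <= m of e^(-2 L) (2 L)^s / s!, which increases geometrically up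
    to s = m < 2 L; and 2^m <= K = e^L, so it is again about e^(-L) L^m / m!.
    By Stirling's formula e^(-L) L^m / m! is K^(-delta) L^(-1/2), up to a
    constant ([weight_center]).

    The three families are handled by one argument about a [factor_system], a
    set of monic polynomials with unique factorization into primes of its own
    and with a character (the constant coefficient) which is equidistributed in
    each degree. The number of primes is not computed from finite fields: it is
    forced by the number of elements, through the identity
    n F(n) = sum_i Lam(i) F(n - i) ([degree_identity], [LamE]). The probability
    that Omega f = j is bounded by the Hardy-Ramanujan induction on j
    ([layer_le_weight]), whose initial case, the density 1/K of the elements
    without prime factors of degree at most K, comes from counting products
    ([layer0_bound]). Prescribing the constant coefficient is paid for by
    one prime power, on which the condition is moved ([constrained_layer_le]).
    The result is [count_multiples_bound].

    Polynomials with nonzero constant coefficient and dagger-symmetric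
    polynomials are such systems as they stand. Star-symmetric polynomials are
    first divided by a factor X + a or X^2 - 1 that their degree and constant
    coefficient force on them; the quotients of even degree and constant
    coefficient 1 form a system for the half degree, with trivial character. *)

Set Implicit Arguments.
Unset Strict Implicit.
Unset Printing Implicit Defensive.

Import Order.TTheory GRing.Theory Num.Theory.
Local Open Scope ring_scope.

(** * Stirling's bound and Poisson weights *)

Section Analysis.
Variable R : realType.
Implicit Types (x l : R) (j m n : nat).

Lemma exp_partial_sum_le x n : 0 <= x ->
  \sum_(0 <= i < n) x ^+ i / i`!%:R <= expR x.
Proof.
move=> x0; rewrite /expR.
apply: (nondecreasing_cvgn_le _ (is_cvg_series_exp_coeff x) n).
by apply: nondecreasing_series => i _ _; apply: exp_coeff_ge0.
Qed.

(** Since 1 / ln 2 < 3/2, the exponent m of the main argument, about log K /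
    ln 2, stays in the range where [weight] has its Poisson form. *)
Lemma ln2_ge : 2 / 3 <= ln 2 :> R.
Proof.
rewrite -ler_expR lnK ?posrE//.
have -> : (2 / 3 : R) = 20%:R * (1 / 30) by lra.
rewrite expRM_natl -[leLHS]invrK -exprVn -expRN.
have h : 0 <= 1 + - (1 / 30) :> R by lra.
have := lerXn2r 20 (x := 1 + - (1 / 30) : R) (y := expR (- (1 / 30))).
rewrite !nnegrE h expR_ge0 expR_ge1Dx => /(_ isT isT isT) le20.
rewrite -[leRHS]invrK lef_pV2 ?posrE ?exprn_gt0 ?expR_gt0 ?invr_gt0//.
by apply: le_trans le20; lra.
Qed.

Lemma ln2_le : ln 2 <= 4 / 5 :> R.
Proof.
rewrite -ler_expR lnK ?posrE//.
have -> : (4 / 5 : R) = 4%:R * (1 / 5) by lra.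
rewrite expRM_natl.
have := lerXn2r 4 (x := 1 + 1 / 5 : R) (y := expR (1 / 5)).
rewrite !nnegrE expR_ge0 expR_ge1Dx => /(_ _ isT isT) le4.
by apply: le_trans (le4 _); lra.
Qed.

(** Stirling's lower bound for m!. The term of index m of the exponential
    series at m is comparable with each of the next sqrt m terms, so sqrt m
    times that term is at most a constant times exp m. *)
Lemma pow_self_div_fact_le m : (0 < m)%N ->
  Num.sqrt m%:R * (m%:R ^+ m / m`!%:R) <= expR 1 * expR m%:R :> R.
Proof.
move=> m0; have m0R : 0 < m%:R :> R by rewrite ltr0n.
pose t := Num.truncn (Num.sqrt m%:R : R).
have /andP[t_le lt_t] := truncn_itv (sqrtr_ge0 (m%:R : R)).
rewrite -/t in t_le lt_t.
have t2 : (t%:R * (t%:R / m%:R) : R) <= 1.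
  rewrite mulrA ler_pdivrMr// mul1r -expr2 -[leRHS]sqr_sqrtr ?ler0n//.
  by rewrite lerXn2r ?nnegrE ?ler0n ?sqrtr_ge0.
pose c : R := m%:R ^+ m / m`!%:R.
have c0 : 0 < c by rewrite divr_gt0 ?exprn_gt0 ?ltr0n ?fact_gt0.
(* the terms of index m, ..., m + t of the series of exp m are all at least
   c / e, since each ratio is at least 1 / (1 + t / m) *)
have term j : (j <= t)%N ->
    c <= (1 + t%:R / m%:R) ^+ j * (m%:R ^+ (m + j) / (m + j)`!%:R).
  elim: j => [|j IH] jt; first by rewrite addn0 expr0 mul1r.
  apply: le_trans (IH (ltnW jt)) _.
  rewrite addnS factS exprS natrM [m%:R ^+ _.+1]exprS.
  rewrite invfM.
  set a := 1 + _; set b := m%:R ^+ _; set f := _.+1%:R^-1; set d := _`!%:R^-1.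
  have -> : a * a ^+ j * (m%:R * b * (f * d)) =
            (a * (m%:R * f)) * (a ^+ j * (b * d)) by ring.
  rewrite ler_peMl//.
    rewrite !mulr_ge0 ?exprn_ge0 ?invr_ge0 ?ler0n// addr_ge0//.
    by rewrite divr_ge0 ?ler0n.
  rewrite mulrA ler_pdivlMr ?ltr0n// mul1r /a mulrDl mul1r.
  rewrite divfK ?gt_eqF// -natrD ler_nat; lia.
have terme j : (j <= t)%N -> c / expR 1 <= m%:R ^+ (m + j) / (m + j)`!%:R.
  move=> jt; rewrite ler_pdivrMr ?expR_gt0// mulrC.
  apply: le_trans (term j jt) _; apply: ler_wpM2r.
    by rewrite divr_ge0 ?exprn_ge0 ?ler0n.
  have a1 : 1 <= 1 + t%:R / m%:R :> R by rewrite lerDl divr_ge0 ?ler0n.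
  apply: le_trans (ler_weXn2l a1 jt) _.
  apply: le_trans (_ : expR (t%:R / m%:R) ^+ t <= _).
    by rewrite lerXn2r ?nnegrE ?expR_ge0 ?expR_ge1Dx// (le_trans _ a1).
  by rewrite -expRM_natl ler_expR.
have := exp_partial_sum_le (m + t.+1) (ltW m0R).
rewrite (big_cat_nat (leq0n m)) ?leq_addr//=.
move=> /(le_trans _) expm.
have {}expm : \sum_(m <= i < m + t.+1) m%:R ^+ i / i`!%:R <= expR m%:R :> R.
  apply: expm; rewrite lerDr sumr_ge0// => i _.
  by rewrite divr_ge0 ?exprn_ge0 ?ler0n.
apply: le_trans (_ : t.+1%:R * c <= _); first by rewrite ler_wpM2r ?ltW.
rewrite -ler_pdivrMl ?expR_gt0//; apply: le_trans expm.
rewrite -{1}[m]add0n big_addn addKn.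
have -> : (expR 1)^-1 * (t.+1%:R * c) = \sum_(0 <= i < t.+1) (c / expR 1).
  by rewrite sumr_const_nat subn0 -mulr_natl; ring.
rewrite !big_mkord; apply: ler_sum => -[i /= it] _.
by rewrite addnC terme.
Qed.

(** Bounds the proportion of elements with j prime factors of small degree, in
    units of the proportion with none. These are the Poisson weights l^j / j!
    as long as j is at most 3 l / 2; beyond, the ratio of consecutive weights
    is kept at 2/3. A ratio bounded below makes it possible to count prime
    factors with multiplicity. *)
Fixpoint weight l (j : nat) : R :=
  if j is i.+1 then weight l i * Num.max (l / i.+1%:R) (2 / 3) else 1.

Lemma weight_gt0 l j : 0 < weight l j.
Proof.
elim: j => [|j IH] /=; first exact: ltr01.
by rewrite mulr_gt0// lt_max; apply/orP; right; lra.
Qed.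

Lemma weight_ge0 l j : 0 <= weight l j. Proof. exact/ltW/weight_gt0. Qed.

(** Losing e prime factors costs a factor (3/2)^e. This absorbs the prime
    powers p^e, whose density decays at least like 2^(-e). *)
Lemma weight_shift l j e : (e <= j)%N ->
  weight l (j - e) <= (3 / 2) ^+ e * weight l j.
Proof.
elim: e => [|e IH] ej; first by rewrite subn0 expr0 mul1r.
apply: le_trans (_ : 3 / 2 * weight l (j - e) <= _); last first.
  by rewrite exprS -(mulrA (3 / 2) (_ ^+ e)) ler_wpM2l ?IH 1?ltnW//; lra.
have -> : (j - e)%N = (j - e.+1).+1 by lia.
rewrite /=; set w := weight _ _; have w0 : 0 <= w := weight_ge0 _ _.
have : 2 / 3 <= Num.max (l / (j - e.+1).+1%:R) (2 / 3) by rewrite le_max lexx orbT.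
set M := Num.max _ _ => hM; nra.
Qed.

Lemma weight_small l j : 2 * j%:R <= 3 * l -> weight l j = l ^+ j / j`!%:R.
Proof.
elim: j => [|j IH] jl /=; first by rewrite expr0 fact0 divr1.
have jl' : 2 * j%:R <= 3 * l by apply: le_trans jl; rewrite ler_pM2l// ler_nat.
rewrite IH// max_l; last first.
  by rewrite ler_pdivlMr ?ltr0n//; move: jl; set J := _%:R; lra.
by rewrite factS natrM invfM exprSr; ring.
Qed.

Lemma geometric_tail (u : nat -> R) m n :
  (forall j, 0 <= u j) -> (forall j, (m <= j)%N -> u j.+1 <= 9 / 10 * u j) ->
  \sum_(m.+1 <= j < n) u j <= 9 * u m.
Proof.
move=> u0 dec.
have [nm|mn] := leqP n m.+1; first by rewrite big_geq// mulr_ge0.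
have tail k : \sum_(m.+1 <= j < m.+1 + k) u j <= 9 * u m - 9 * u (m + k)%N.
  elim: k => [|k IH]; first by rewrite !addn0 big_geq// subrr.
  rewrite addnS big_nat_recr ?leq_addr//= addnS.
  have := dec (m + k)%N (leq_addr _ _); lra.
rewrite -(subnKC (ltnW mn)).
by have := tail (n - m.+1)%N; have := u0 (m + (n - m.+1))%N; lra.
Qed.

Lemma geometric_head (u : nat -> R) m :
  (forall j, (j <= m)%N -> 0 <= u j) ->
  (forall j, (j < m)%N -> u j <= 3 / 4 * u j.+1) ->
  \sum_(0 <= j < m.+1) u j <= 4 * u m.
Proof.
elim: m => [|m IH] u0 inc.
  by rewrite big_nat1; have := u0 0%N isT; lra.
rewrite big_nat_recr//=.
have := IH (fun j jm => u0 j (leqW jm)) (fun j jm => inc j (leqW jm)).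
by have := inc m (leqnn _); lra.
Qed.

End Analysis.

(** * The decay function and the Poisson weights at log K / log 2 *)

Section Decay.
Variable R : realType.
Implicit Types (K k m n : nat) (B : R).

Lemma decayE K : (0 < K)%N ->
  decay R K = expR (- delta R * ln K%:R) / Num.sqrt (1 + ln K%:R).
Proof.
move=> K0; rewrite /decay {1}/powR pnatr_eq0 gtn_eqF//.
have L0 : 0 <= ln K%:R :> R by rewrite ln_ge0// ler1n.
by rewrite powRN mul1r powR12_sqrt ?addr_ge0.
Qed.

Lemma decay_gt0 K : (0 < K)%N -> 0 < decay R K.
Proof.
move=> K0; rewrite decayE// divr_gt0 ?expR_gt0// sqrtr_gt0.
by rewrite ltr_pwDl// ln_ge0// ler1n.
Qed.

(** Makes the bounds trivial as long as K stays bounded. *)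
Lemma decay_lower_bound B : exists2 c : R, 0 < c &
  forall K, (0 < K)%N -> ln K%:R <= B -> c <= decay R K.
Proof.
exists (expR (- `|delta R| * `|B|) / Num.sqrt (1 + `|B|)).
  by rewrite divr_gt0 ?expR_gt0// sqrtr_gt0 ltr_pwDl.
move=> K K0 KB; have L0 : 0 <= ln K%:R :> R by rewrite ln_ge0// ler1n.
have {}KB : ln K%:R <= `|B| by apply: le_trans KB (ler_norm _).
rewrite decayE//; apply: ler_pM.
- exact: expR_ge0.
- by rewrite invr_ge0 sqrtr_ge0.
- rewrite ler_expR; apply: le_trans (_ : - (`|delta R| * ln K%:R) <= _).
    by rewrite mulNr lerN2 ler_wpM2l.
  by rewrite mulNr lerN2 ler_wpM2r// ler_norm.
- rewrite lef_pV2 ?posrE ?sqrtr_gt0 ?ltr_pwDl// ler_wsqrtr//.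
  by rewrite lerD2l.
Qed.

(** Allows an argument with a parameter K smaller than k by a constant factor. *)
Lemma decay_comparable : exists2 C : R, 0 < C &
  forall K k, (0 < K)%N -> (K <= k)%N -> (k <= 6 * K)%N ->
    decay R K <= C * decay R k.
Proof.
have l6 : 0 <= ln 6 :> R by rewrite ln_ge0// ler1n.
exists (expR (`|delta R| * ln 6) * Num.sqrt (1 + ln 6)).
  by rewrite mulr_gt0 ?expR_gt0// sqrtr_gt0 ltr_pwDl.
move=> K k K0 Kk kK; have k0 := leq_trans K0 Kk.
have LK : 0 <= ln K%:R :> R by rewrite ln_ge0// ler1n.
have Lk : ln K%:R <= ln k%:R :> R by rewrite ler_ln ?posrE ?ltr0n// ler_nat.
have Lk6 : ln k%:R <= ln 6 + ln K%:R :> R.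
  rewrite -lnM ?posrE ?ltr0n//.
  by rewrite ler_ln ?posrE -?natrM ?ltr0n ?muln_gt0 ?K0// ler_nat.
rewrite !decayE// mulrACA; apply: ler_pM.
- exact: expR_ge0.
- by rewrite invr_ge0 sqrtr_ge0.
- rewrite -expRD ler_expR -subr_ge0.
  have -> : `|delta R| * ln 6 + - delta R * ln k%:R - - delta R * ln K%:R =
            `|delta R| * ln 6 - delta R * (ln k%:R - ln K%:R) by ring.
  rewrite subr_ge0; apply: le_trans (_ : `|delta R| * (ln k%:R - ln K%:R) <= _).
    by rewrite ler_wpM2r ?subr_ge0// ler_norm.
  by rewrite ler_wpM2l// lerBlDr.
- rewrite ler_pdivlMr ?sqrtr_gt0 ?ltr_pwDl// ?(le_trans LK)//.
  rewrite ler_pdivrMl ?sqrtr_gt0 ?ltr_pwDl// -sqrtrM ?addr_ge0//.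
  rewrite ler_wsqrtr//; nra.
Qed.

(** Bounds the mean number of prime factors of degree at most K; the constant
    covers prime powers and the error terms in the number of primes. *)
Definition mean_bound K : R := ln K%:R + 11%:R.

Section LargeK.
Variable K : nat.
Hypothesis K_large : 88%:R <= ln K%:R :> R.
Local Notation L := (ln K%:R : R).
Local Notation l := (mean_bound K).
Let m := trunc_log 2 K.

Let K_gt0 : (0 < K)%N.
Proof. by case: K K_large => //; rewrite ln0//; lra. Qed.

Lemma pow2_trunc_log_le : 2 ^+ m <= K%:R :> R.
Proof. by rewrite -natrX ler_nat trunc_logP. Qed.

Lemma trunc_log_le_ln : m%:R * ln 2 <= L.
Proof.
by rewrite mulr_natl -lnXn// ler_ln ?posrE ?exprn_gt0 ?ltr0n ?pow2_trunc_log_le.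
Qed.

Lemma ln_lt_trunc_log : L < (m%:R + 1) * ln 2.
Proof.
rewrite natr1 mulr_natl -lnXn// ltr_ln ?posrE ?exprn_gt0 ?ltr0n//.
by rewrite -natrX ltr_nat trunc_log_ltn.
Qed.

Lemma ln_le_trunc_log : L <= 4 / 5 * (m%:R + 1).
Proof.
have := ln2_le R; have := ln_lt_trunc_log; have := ler0n R m; nra.
Qed.

Lemma trunc_log_large : 100%:R <= m%:R :> R.
Proof. by have := ln_le_trunc_log; have := K_large; lra. Qed.

Lemma trunc_log_le_scaled_ln : m%:R <= 3 / 2 * L.
Proof. by have := ln2_ge R; have := trunc_log_le_ln; have := ler0n R m; nra. Qed.

(** Beyond m the ratio of consecutive weights is at most (L + 11) / (m + 1),
    and m + 1 > L / ln 2 with ln 2 <= 4/5; this is where L has to be large. *)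
Lemma weight_tail n : \sum_(m.+1 <= j < n) weight l j <= 9 * weight l m.
Proof.
apply: geometric_tail => [j|j mj]; first exact: weight_ge0.
rewrite /= mulrC ler_wpM2r ?weight_ge0// ge_max; apply/andP; split; last by lra.
rewrite ler_pdivrMr ?ltr0n// -natr1 /l /mean_bound.
have : m%:R <= j%:R :> R by rewrite ler_nat.
by have := ln_le_trunc_log; have := K_large; lra.
Qed.

Lemma weight_le_trunc_log j : (j <= m)%N -> weight l j = l ^+ j / j`!%:R.
Proof.
rewrite -(ler_nat R) => jm; apply: weight_small; rewrite /mean_bound.
by have := trunc_log_le_scaled_ln; lra.
Qed.

(** By the binomial theorem the inner sum is (2 l)^s / s!, the Poisson weight
    for the total number of prime factors of a pair. It increases
    geometrically up to s = m, since m <= 3 l / 2, and the last one is 2^m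
    times [weight l m], where 2^m <= K. *)
Lemma weight_pairs :
  \sum_(0 <= s < m.+1) \sum_(0 <= j < s.+1) weight l j * weight l (s - j) <=
  4 * K%:R * weight l m.
Proof.
have l0 : 0 <= l by have := K_large; rewrite /mean_bound; lra.
have -> : \sum_(0 <= s < m.+1) \sum_(0 <= j < s.+1)
            weight l j * weight l (s - j) =
          \sum_(0 <= s < m.+1) (2 * l) ^+ s / s`!%:R.
  apply: eq_big_nat => s; rewrite leq0n/= ltnS => sm.
  rewrite mulr_natl mulr2n exprDn big_mkord mulr_suml; apply: eq_bigr => j _.
  have js : (j <= s)%N by rewrite -ltnS.
  rewrite !weight_le_trunc_log ?(leq_trans _ sm) ?leq_subr//.
  have /(congr1 (GRing.natmul (1 : R))) := bin_fact js; rewrite !natrM => <-.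
  rewrite -mulr_natl.
  have f0 i : i`!%:R != 0 :> R by rewrite pnatr_eq0 gtn_eqF ?fact_gt0.
  have b0 : 'C(s, j)%:R != 0 :> R by rewrite pnatr_eq0 gtn_eqF ?bin_gt0.
  by field; rewrite !f0 b0.
apply: le_trans (geometric_head (m := m) _ _) _ => [j _|j jm|].
- by rewrite divr_ge0 ?exprn_ge0 ?mulr_ge0 ?ler0n.
- rewrite factS natrM exprS invfM.
  set a := _ ^+ j; set b := _`!%:R^-1; set d := j.+1%:R^-1.
  have -> : 3 / 4 * (2 * l * a * (d * b)) = (3 / 2 * l * d) * (a * b) by field.
  rewrite ler_peMl//.
    by rewrite mulr_ge0 ?invr_ge0 ?ler0n ?exprn_ge0 ?mulr_ge0.
  rewrite ler_pdivlMr ?ltr0n// mul1r.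
  have : j.+1%:R <= m%:R :> R by rewrite ler_nat.
  by have := trunc_log_le_scaled_ln; rewrite /mean_bound; lra.
- rewrite -mulrA ler_wpM2l// weight_le_trunc_log// exprMn -mulrA.
  rewrite ler_wpM2r ?pow2_trunc_log_le//.
  by rewrite divr_ge0 ?exprn_ge0 ?ler0n.
Qed.

(** By Stirling's formula L^m / m! is at most a constant times (e L / m)^m /
    sqrt m, and for m close to L / ln 2 the power (e L / m)^m is comparable
    with (e ln 2)^(L / ln 2) = K^(1 - delta). *)
Lemma weight_center :
  weight l m / K%:R <= expR 20%:R * Num.sqrt 2 * decay R K.
Proof.
have m100 := trunc_log_large; have L88 := K_large.
have m0 : (0 < m)%N by rewrite -(ltr0n R); lra.
have l2 := ln2_ge R; have l2' := ln2_le R.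
have mL := trunc_log_le_ln; have m3 := trunc_log_le_scaled_ln.
have Lm := ln_lt_trunc_log.
have K0 : 0 < K%:R :> R by rewrite ltr0n.
have mR0 : 0 < m%:R :> R by rewrite ltr0n.
rewrite weight_le_trunc_log//.
pose x := L / ln 2.
have xE : L = x * ln 2 by rewrite divfK// gt_eqF//; lra.
have mx : m%:R <= x by rewrite ler_pdivlMr//; lra.
have xm : x <= m%:R + 1 by rewrite ler_pdivrMr ?ltW//; lra.
(* l ^ m exceeds L ^ m by at most a constant factor because m = O(L) *)
have lm : l ^+ m <= expR 17%:R * L ^+ m.
  have -> : l = L * (1 + 11%:R / L).
    by rewrite mulrDr mulr1 mulrC divfK// gt_eqF//; lra.
  rewrite exprMn mulrC ler_wpM2r ?exprn_ge0//; first by lra.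
  apply: le_trans (_ : expR (11%:R / L) ^+ m <= _).
    rewrite lerXn2r ?nnegrE ?expR_ge0 ?expR_ge1Dx//.
    by rewrite addr_ge0// divr_ge0//; lra.
  rewrite -expRM_natl ler_expR mulrA ler_pdivrMr//; first by lra.
  nra.
(* (x / m) ^ m <= exp (x - m) *)
have Lpow : L ^+ m <= expR 1 * (m%:R * ln 2) ^+ m.
  rewrite {1}xE.
  have -> : x = m%:R * (x / m%:R) by rewrite mulrC divfK// gt_eqF.
  rewrite mulrAC exprMn mulrC ler_wpM2r ?exprn_ge0//.
    by rewrite mulr_ge0//; lra.
  apply: le_trans (_ : expR (x / m%:R - 1) ^+ m <= _).
    rewrite lerXn2r ?nnegrE ?expR_ge0//; first by rewrite divr_ge0//; lra.
    by apply: le_trans (expR_ge1Dx _); rewrite addrC subrK.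
  rewrite -expRM_natl ler_expR mulrBr mulr1 mulrC divfK ?gt_eqF//; lra.
have Lsqrt : Num.sqrt (1 + L) <= Num.sqrt 2 * Num.sqrt m%:R.
  by rewrite -sqrtrM// ler_wsqrtr//; nra.
have stir := pow_self_div_fact_le R m0.
have dec : expR m%:R * ln 2 ^+ m / K%:R <= expR (- delta R * L).
  rewrite -{1}[ln 2]lnK ?posrE; last by lra.
  rewrite -{1}[K%:R]lnK ?posrE// -expRM_natl -expRN -!expRD ler_expR.
  have -> : - delta R * L = (1 + ln (ln 2)) * x - L.
    by rewrite /delta /x; field; rewrite gt_eqF//; lra.
  rewrite lerD2r -[X in X + _ <= _]mulr1 -mulrDr mulrC ler_wpM2l//.
  have : ln (2 / 3) <= ln (ln 2) :> R by rewrite ler_ln ?posrE//; lra.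
  have : - ln (2 / 3) <= 1 :> R.
    rewrite -lnV ?posrE; last by lra.
    have -> : (2 / 3)^-1 = 1 + 1 / 2 :> R by field.
    by apply: le_trans (le_ln1Dx _) _; lra.
  lra.
rewrite decayE//.
have s0 : 0 < Num.sqrt (1 + L) by rewrite sqrtr_gt0; lra.
rewrite mulrA ler_pdivlMr//.
have sm0 : 0 < Num.sqrt (m%:R : R) by rewrite sqrtr_gt0.
set c := _`!%:R in stir *.
have c0 : 0 < c by rewrite ltr0n fact_gt0.
have p0 : 0 <= (c * K%:R)^-1 by rewrite invr_ge0 ltW// mulr_gt0.
rewrite -[l ^+ m / c / _]mulrA -invfM.
apply: le_trans (ler_wpM2r (ltW s0) (ler_wpM2r p0 lm)) _.
apply: le_trans (_ : expR 17%:R * (expR 1 * (m%:R * ln 2) ^+ m) / (c * K%:R)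
   * (Num.sqrt 2 * Num.sqrt m%:R) <= _).
  apply: ler_pM => //; last 1 first.
  - by rewrite ler_wpM2r// ler_wpM2l ?expR_ge0.
  - by rewrite mulr_ge0// mulr_ge0 ?expR_ge0 ?exprn_ge0//; lra.
  - exact: ltW.
have -> : expR 17%:R * (expR 1 * (m%:R * ln 2) ^+ m) / (c * K%:R)
      * (Num.sqrt 2 * Num.sqrt m%:R) =
   expR 17%:R * expR 1 * Num.sqrt 2 * (ln 2 ^+ m / K%:R) *
   (Num.sqrt m%:R * (m%:R ^+ m / c)).
  by rewrite exprMn; field; rewrite !gt_eqF.
have e0 : (0 : R) <= expR 17%:R * expR 1 * Num.sqrt 2 * (ln 2 ^+ m / K%:R).
  apply: mulr_ge0.
    by rewrite !mulr_ge0 ?expR_ge0 ?sqrtr_ge0.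
  by rewrite mulr_ge0 ?exprn_ge0 ?invr_ge0 ?(ltW K0)//; lra.
apply: le_trans (ler_wpM2l e0 stir) _.
have -> : expR 17%:R * expR 1 * Num.sqrt 2 * (ln 2 ^+ m / K%:R) *
    (expR 1 * expR m%:R) =
  (expR 17%:R * expR 1 * expR 1 * Num.sqrt 2) *
    (expR m%:R * ln 2 ^+ m / K%:R) :> R.
  by ring.
apply: ler_pM dec => //.
- by rewrite !mulr_ge0 ?expR_ge0 ?sqrtr_ge0.
- by rewrite !mulr_ge0 ?expR_ge0 ?exprn_ge0 ?invr_ge0//; lra.
- rewrite ler_wpM2r ?sqrtr_ge0// -!expRD ler_expR; lra.
Qed.

End LargeK.
End Decay.

(** * Unique factorization in systems of monic polynomials *)

(** Sets of monic polynomials closed under products, exact quotients and, by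
    [mem_common], common divisors have unique factorization into primes of
    their own. They are graded by [deg], and a character [chi] with finitely
    many values is equidistributed in each positive degree: every value is
    taken base^n / ratio times. The last two fields bound the distance of
    #|values| / ratio from 1 by 1 / base. This is all that the counting uses,
    for the three families of polynomials at once. *)
Record factor_system (F : finFieldType) := FactorSystem {
  in_system : pred {poly F};
  deg : {poly F} -> nat;
  elems : nat -> seq {poly F};
  chi : {poly F} -> F;
  values : {set F};
  base : nat;
  ratio : nat;
  mem_monic : forall f, in_system f -> f \is monic;
  mem1 : in_system 1;
  memM : forall f g, in_system f -> in_system g -> in_system (f * g);
  mem_div : forall f g, in_system f -> in_system (f * g) -> in_system g;
  mem_common : forall f g, in_system f -> in_system g -> ~~ coprimep f g ->
    exists d, [/\ in_system d, d != 1, d %| f & d %| g];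
  degM : forall f g, in_system f -> in_system g -> deg (f * g) = (deg f + deg g)%N;
  deg_eq0 : forall f, in_system f -> deg f = 0%N -> f = 1;
  elems_uniq : forall n, uniq (elems n);
  elemsE : forall n f, (f \in elems n) = in_system f && (deg f == n);
  chi_values : forall f, in_system f -> chi f \in values;
  chiM : forall f g, in_system f -> in_system g -> chi (f * g) = chi f * chi g;
  values_neq0 : forall c, c \in values -> c != 0;
  values_div : forall b c, b \in values -> c \in values -> c / b \in values;
  base_ge2 : (2 <= base)%N;
  ratio_gt0 : (0 < ratio)%N;
  ratio_le_base : (ratio <= base)%N;
  card_elems : forall n c, (0 < n)%N -> c \in values ->
    (ratio * count (fun f => chi f == c) (elems n) = base ^ n)%N;
  card_values_ge : (ratio * base <= #|values| * base + ratio)%N;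
  card_values_le : (#|values| * base <= ratio * base + ratio)%N
}.

Section Factorization.
Variables (F : finFieldType) (S : factor_system F).
Local Notation in_system := (in_system S).
Local Notation deg := (deg S).
Local Notation elems := (elems S).
Local Notation chi := (chi S).
Implicit Types (f g p : {poly F}) (n d e i : nat).

Lemma mem_neq0 f : in_system f -> f != 0.
Proof. by move=> /mem_monic /monic_neq0. Qed.

Lemma deg1 : deg 1 = 0%N.
Proof. by have := degM (mem1 S) (mem1 S); rewrite mulr1; lia. Qed.

Lemma memX p e : in_system p -> in_system (p ^+ e).
Proof.
move=> pS; elim: e => [|e IH]; first by rewrite expr0 mem1.
by rewrite exprS memM.
Qed.

Lemma degX p e : in_system p -> deg (p ^+ e) = (e * deg p)%N.
Proof.
move=> pS; elim: e => [|e IH]; first by rewrite expr0 deg1.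
by rewrite exprS degM ?memX// IH mulSn.
Qed.

Lemma chi1 : chi 1 = 1.
Proof.
have := chiM (mem1 S) (mem1 S).
rewrite mulr1 -{1}[chi 1]mulr1 => /mulfI -> //.
exact/(@values_neq0 _ S)/chi_values/mem1.
Qed.

Lemma chiX p e : in_system p -> chi (p ^+ e) = chi p ^+ e.
Proof.
move=> pS; elim: e => [|e IH]; first by rewrite !expr0 chi1.
by rewrite !exprS chiM ?memX// IH.
Qed.

Lemma mem_dvdP f g : in_system f -> in_system g ->
  reflect (exists2 h, in_system h & g = f * h) (f %| g).
Proof.
move=> fS gS; apply: (iffP idP) => [/dvdpP[h gE]|[h _ ->]]; last first.
  exact: dvdp_mulr.
rewrite mulrC in gE; exists h => //.
by apply: (mem_div fS); rewrite -gE.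
Qed.

Lemma mem_dvd_deg f g : in_system f -> in_system g -> f %| g -> (deg f <= deg g)%N.
Proof.
by move=> fS gS /(mem_dvdP fS gS)[h hS ->]; rewrite degM// leq_addr.
Qed.

Lemma elems0 : elems 0 = [:: 1].
Proof.
have u := elems_uniq S 0; have e := elemsE S 0.
have : perm_eq (elems 0) [:: 1].
  apply: uniq_perm => // f; rewrite e inE; apply/andP/eqP => [[fS /eqP]|->].
    exact: deg_eq0.
  by rewrite mem1 deg1.
by move=> /perm_size; case: (elems 0) e => [|x []]// /(_ x);
   rewrite !inE eqxx => /esym/andP[xS /eqP/(deg_eq0 xS)->].
Qed.

(** A prime of the system can be reducible as a polynomial, such as the
    product of an irreducible polynomial and its dual. *)
Definition prime_elem p :=
  [&& in_system p, p != 1 &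
      all (fun i => all (fun g => ~~ (g %| p)) (elems i)) (iota 1 (deg p).-1)].

Lemma prime_mem p : prime_elem p -> in_system p.
Proof. by case/and3P. Qed.

Lemma deg_gt0 f : in_system f -> f != 1 -> (0 < deg f)%N.
Proof.
by move=> fS f1; rewrite lt0n; apply: contra f1 => /eqP/(deg_eq0 fS)->.
Qed.

Lemma prime_deg_gt0 p : prime_elem p -> (0 < deg p)%N.
Proof. by case/and3P => pS p1 _; apply: deg_gt0. Qed.

Lemma prime_dvd_eq p g : prime_elem p -> in_system g -> g != 1 -> g %| p -> g = p.
Proof.
move=> /and3P[pS p1 /allP irr] gS g1 gp.
have /(mem_dvdP gS pS)[h hS pE] := gp.
have degp : deg p = (deg g + deg h)%N by rewrite {1}pE degM.
have [h0|h0] := posnP (deg h); first by rewrite pE (deg_eq0 hS h0) mulr1.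
have g0 := deg_gt0 gS g1.
have /irr/allP/(_ g) : deg g \in iota 1 (deg p).-1 by rewrite mem_iota; lia.
by rewrite elemsE gS eqxx gp => /(_ isT).
Qed.

Lemma exists_prime_dvd f : in_system f -> f != 1 ->
  exists2 p, prime_elem p & p %| f.
Proof.
have [n] := ubnP (deg f); elim: n f => // n IH f fn fS f1.
have [fp|] := boolP (prime_elem f); first by exists f.
rewrite /prime_elem fS f1/= => /allPn[i]; rewrite mem_iota => i1.
move=> /allPn[g]; rewrite elemsE negbK => /andP[gS /eqP gi] gf.
have g1 : g != 1 by apply/eqP => ge; move: gi; rewrite ge deg1; lia.
have [|p pp pg] := IH g _ gS g1; first by lia.
by exists p => //; apply: dvdp_trans gf.
Qed.

Lemma prime_coprime p f : prime_elem p -> in_system f -> ~~ (p %| f) ->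
  coprimep p f.
Proof.
move=> pp fS; apply: contraR => /(mem_common (prime_mem pp) fS).
by case=> d [dS d1 dp]; rewrite (prime_dvd_eq pp dS d1 dp).
Qed.

(** Euclid's lemma: distinct primes have no common divisor in the system, so
    by [mem_common] they are coprime polynomials. *)
Lemma prime_power_dvd_mul p r g e : prime_elem p -> prime_elem r -> in_system g ->
  p != r -> (p ^+ e %| r * g) = (p ^+ e %| g).
Proof.
move=> pp rp gS pr; rewrite Gauss_dvdpr// coprimep_expl//.
apply: prime_coprime => //; first exact: prime_mem.
apply: contra pr => pr; apply/eqP/(prime_dvd_eq rp) => //.
- exact: prime_mem.
- by case/and3P: pp.
Qed.

Definition primes_of_deg d : seq {poly F} := [seq p <- elems d | prime_elem p].

Lemma primes_of_degE d p :
  (p \in primes_of_deg d) = prime_elem p && (deg p == d).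
Proof.
rewrite mem_filter elemsE; have [/prime_mem->|] := boolP (prime_elem p) => //.
Qed.

Lemma primes_of_deg_uniq d : uniq (primes_of_deg d).
Proof. by rewrite filter_uniq// elems_uniq. Qed.

(* All degrees considered are at most N, so that the sums over primes and
   exponents have a finite range which does not depend on the polynomial. *)
Variable N : nat.

Definition valuation p f : nat := \sum_(1 <= e < N.+1) (p ^+ e %| f)%R.

Lemma valuation1 p : prime_elem p -> valuation p 1 = 0%N.
Proof.
move=> pp; rewrite /valuation big_nat big1// => e /andP[e0 _].
rewrite (_ : _ %| 1 = false)//; apply/negP.
move=> /(mem_dvd_deg (memX _ (prime_mem pp)) (mem1 S)).
by rewrite degX ?prime_mem// deg1; have := prime_deg_gt0 pp; nia.
Qed.

Lemma valuation_mul_prime p r g : prime_elem p -> prime_elem r -> in_system g ->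
  (deg (r * g) <= N)%N ->
  valuation p (r * g) = ((p == r) + valuation p g)%N.
Proof.
move=> pp rp gS; rewrite degM ?(prime_mem rp)// => degN; rewrite /valuation.
have [pr|pr] := eqVneq p r; last first.
  by apply: eq_bigr => e _; rewrite prime_power_dvd_mul.
rewrite -{}pr in rp degN *.
have p0 := prime_deg_gt0 pp; have pS := prime_mem pp.
have N0 : (0 < N)%N by lia.
have pN : (p ^+ N %| g) = false.
  apply/negP => /(mem_dvd_deg (memX _ pS) gS); rewrite degX//; nia.
rewrite [in RHS]big_nat_recr//= pN addn0 big_add1/=.
rewrite [in LHS]big_ltn// expr1 dvdp_mulr ?dvdpp//; congr (_ + _)%N.
apply: eq_big_nat => e _.
by rewrite exprS dvdp_mul2l// mem_neq0.
Qed.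

(** The completely additive function with value w (deg p) at each prime p. For
    w d = d it is the degree; for the indicator of d <= K it counts prime
    factors of small degree with multiplicity. *)
Definition additive_extension (w : nat -> nat) f : nat :=
  \sum_(1 <= d < N.+1) \sum_(p <- primes_of_deg d) valuation p f * w d.

Lemma additive_extension_mul_prime w r g : prime_elem r -> in_system g ->
  (deg (r * g) <= N)%N ->
  additive_extension w (r * g) = (w (deg r) + additive_extension w g)%N.
Proof.
move=> rp gS degN; have r0 := prime_deg_gt0 rp.
have rN : (deg r <= N)%N by move: degN; rewrite degM ?(prime_mem rp)//; lia.
rewrite /additive_extension.
have -> : w (deg r) = (\sum_(1 <= d < N.+1) \sum_(p <- primes_of_deg d)
                        (p == r) * w d)%N.
  have sum_eq_mem d : (\sum_(p <- primes_of_deg d) (p == r) =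
                       (r \in primes_of_deg d))%N.
    rewrite -count_uniq_mem ?primes_of_deg_uniq// -sum1_count [RHS]big_mkcond.
    by apply: eq_bigr => p _ /=; case: eqP.
  rewrite (bigD1_seq (deg r)) ?iota_uniq ?mem_index_iota ?r0//=.
  rewrite -big_distrl/= sum_eq_mem primes_of_degE rp eqxx mul1n.
  rewrite big1 ?addn0// => d dr.
  by rewrite -big_distrl/= sum_eq_mem primes_of_degE rp eq_sym (negPf dr).
rewrite -big_split/=; apply: eq_bigr => d _; rewrite -big_split/=.
rewrite big_seq [RHS]big_seq; apply: eq_bigr => p.
rewrite primes_of_degE => /andP[pp _].
by rewrite valuation_mul_prime// mulnDl.
Qed.

Lemma additive_extension1 w : additive_extension w 1 = 0%N.
Proof.
rewrite /additive_extension big1// => d _; rewrite big_seq big1// => p.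
by rewrite primes_of_degE => /andP[pp _]; rewrite valuation1.
Qed.

Lemma additive_extensionM w f g : in_system f -> in_system g ->
  (deg (f * g) <= N)%N ->
  additive_extension w (f * g) =
  (additive_extension w f + additive_extension w g)%N.
Proof.
have [n] := ubnP (deg f); elim: n f => // n IH f fn fS gS degN.
have [->|f1] := eqVneq f 1; first by rewrite mul1r additive_extension1.
have [p pp] := exists_prime_dvd fS f1; have pS := prime_mem pp.
move=> /(mem_dvdP pS fS)[h hS fE].
have p0 := prime_deg_gt0 pp.
move: fn degN; rewrite fE -mulrA !degM ?memM// => fn degN.
rewrite (additive_extension_mul_prime _ pp (memM hS gS)); last first.
  by rewrite !degM ?memM//; lia.
rewrite (additive_extension_mul_prime _ pp hS); last by rewrite degM//; lia.
by rewrite IH// ?degM//; lia.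
Qed.

Lemma additive_extension_deg f : in_system f -> (deg f <= N)%N ->
  additive_extension id f = deg f.
Proof.
have [n] := ubnP (deg f); elim: n f => // n IH f fn fS degN.
have [->|f1] := eqVneq f 1; first by rewrite additive_extension1 deg1.
have [p pp] := exists_prime_dvd fS f1; have pS := prime_mem pp.
move=> /(mem_dvdP pS fS)[h hS fE].
have p0 := prime_deg_gt0 pp.
move: fn degN; rewrite fE !degM ?memM// => fn degN.
by rewrite (additive_extension_mul_prime _ pp hS) ?degM// IH//; lia.
Qed.

End Factorization.

(** * Counting prime powers *)

Section PrimePowerSums.
Variables (R : realType) (F : finFieldType) (S : factor_system F) (N : nat).
Local Notation in_system := (in_system S).
Local Notation deg := (deg S).
Local Notation elems := (elems S).
Local Notation chi := (chi S).
Local Notation primes_of_deg := (primes_of_deg S).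
Local Notation Q := ((base S)%:R : R).
Local Notation D := ((ratio S)%:R : R).
Implicit Types (f g p : {poly F}) (n d e i : nat) (c : F).

Definition prime_power_sum (h : nat -> {poly F} -> nat -> R) : R :=
  \sum_(1 <= d < N.+1) \sum_(p <- primes_of_deg d) \sum_(1 <= e < N.+1) h d p e.

Definition prime_power_index d p e :=
  [&& (0 < d <= N)%N, prime_elem S p, deg p == d & (0 < e <= N)%N].

Lemma eq_prime_power_sum h1 h2 :
  (forall d p e, prime_power_index d p e -> h1 d p e = h2 d p e) ->
  prime_power_sum h1 = prime_power_sum h2.
Proof.
move=> h12; apply: eq_big_nat => d dN; apply: eq_big_seq => p.
rewrite primes_of_degE => /andP[pp pd]; apply: eq_big_nat => e eN; apply: h12.
by rewrite /prime_power_index dN eN pp pd.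
Qed.

Lemma ler_prime_power_sum h1 h2 :
  (forall d p e, prime_power_index d p e -> h1 d p e <= h2 d p e) ->
  prime_power_sum h1 <= prime_power_sum h2.
Proof.
move=> h12; rewrite /prime_power_sum big_nat [leRHS]big_nat.
apply: ler_sum => d dN; rewrite big_seq [leRHS]big_seq; apply: ler_sum => p.
rewrite primes_of_degE => /andP[pp pd]; rewrite big_nat [leRHS]big_nat.
apply: ler_sum => e eN; apply: h12.
by rewrite /prime_power_index dN eN pp pd.
Qed.

Lemma prime_power_sumD h1 h2 :
  prime_power_sum (fun d p e => h1 d p e + h2 d p e) =
  prime_power_sum h1 + prime_power_sum h2.
Proof.
rewrite -big_split/=; apply: eq_bigr => d _.
rewrite -big_split/=; apply: eq_bigr => p _.
by rewrite -big_split.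
Qed.

Lemma exchange_prime_power_sum (I : Type) (r : seq I) (P : pred I)
    (h : I -> nat -> {poly F} -> nat -> R) :
  \sum_(i <- r | P i) prime_power_sum (h i) =
  prime_power_sum (fun d p e => \sum_(i <- r | P i) h i d p e).
Proof.
rewrite exchange_big/=; apply: eq_bigr => d _.
rewrite exchange_big/=; apply: eq_bigr => p _.
by rewrite exchange_big.
Qed.

Lemma prime_power_sumMl a h :
  a * prime_power_sum h = prime_power_sum (fun d p e => a * h d p e).
Proof.
rewrite mulr_sumr; apply: eq_bigr => d _.
rewrite mulr_sumr; apply: eq_bigr => p _.
by rewrite mulr_sumr.
Qed.

Lemma sum_multiples (phi : {poly F} -> R) n g : in_system g ->
  \sum_(f <- elems n | g %| f) phi f =
  if (deg g <= n)%N then \sum_(f <- elems (n - deg g)) phi (g * f) else 0.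
Proof.
move=> gS; case: leqP => gn; last first.
  rewrite big_seq_cond big1// => f /andP[]; rewrite elemsE => /andP[fS /eqP fn].
  by move=> /(mem_dvd_deg gS fS); rewrite fn leqNgt gn.
rewrite -big_filter -(big_map (fun f => g * f) xpredT phi).
apply: perm_big; apply: uniq_perm.
- by rewrite filter_uniq// elems_uniq.
- rewrite map_inj_uniq ?elems_uniq// => f1 f2; apply: mulfI.
  exact: mem_neq0 gS.
move=> f; rewrite mem_filter elemsE; apply/idP/mapP => [|[h]].
  move=> /and3P[gf fS /eqP fn]; have /(mem_dvdP gS fS)[h hS fE] := gf.
  exists h => //; rewrite elemsE hS -fn fE degM// addKn eqxx//.
rewrite elemsE => /andP[hS /eqP hn] ->.
by rewrite dvdp_mulr// memM// degM//= hn subnKC.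
Qed.

(** Expands the additive function over the prime powers dividing f and
    substitutes f = p^e f'. All the counting below comes from this identity,
    with various w and phi. *)
Lemma sum_additive_extension (w : nat -> nat) (phi : {poly F} -> R) n :
  \sum_(f <- elems n) (additive_extension S N w f)%:R * phi f =
  prime_power_sum (fun d p e => (w d)%:R *
    if (e * d <= n)%N then \sum_(f <- elems (n - e * d)) phi (p ^+ e * f)
    else 0).
Proof.
have -> : \sum_(f <- elems n) (additive_extension S N w f)%:R * phi f =
    \sum_(f <- elems n) prime_power_sum
      (fun d p e => (w d)%:R * ((p ^+ e %| f)%R%:R * phi f)).
  apply: eq_bigr => f _.
  rewrite natr_sum mulr_suml; apply: eq_bigr => d _.
  rewrite natr_sum mulr_suml; apply: eq_bigr => p _.
  rewrite natrM natr_sum mulr_suml mulr_suml; apply: eq_bigr => e _.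
  by rewrite mulrCA mulrA.
rewrite exchange_prime_power_sum; apply: eq_prime_power_sum => d p e.
move=> /and4P[_ /prime_mem pS /eqP pd _].
rewrite -mulr_sumr; congr (_ * _).
rewrite -pd -degX// -sum_multiples ?memX// [RHS]big_mkcond/=.
by apply: eq_bigr => f _; case: ifP; rewrite ?mul1r ?mul0r.
Qed.

(** The analogue of the von Mangoldt function, summed over degree n. *)
Definition Lam n : R := prime_power_sum (fun d p e => (e * d == n)%N%:R * d%:R).

Definition LamC c n : R :=
  prime_power_sum (fun d p e => ((e * d == n)%N && (chi p ^+ e == c))%:R * d%:R).

Lemma base_gt0 : 0 < Q. Proof. by rewrite ltr0n; have := base_ge2 S; lia. Qed.

Lemma ratio_gt0R : 0 < D. Proof. by rewrite ltr0n ratio_gt0. Qed.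

Lemma chi_neq0 f : in_system f -> chi f != 0.
Proof. by move=> /chi_values; apply: values_neq0. Qed.

Lemma sum_chi n c : (0 < n)%N -> c \in values S ->
  \sum_(f <- elems n) (chi f == c)%:R = Q ^+ n / D.
Proof.
move=> n0 cV; apply/eqP; rewrite eq_sym -subr_eq0.
have -> : \sum_(f <- elems n) (chi f == c)%:R =
          (count (fun f => chi f == c) (elems n))%:R :> R.
  rewrite -sum1_count natr_sum [RHS]big_mkcond.
  by apply: eq_bigr => f _; case: eqP.
have /(congr1 (GRing.natmul (1 : R))) := card_elems n0 cV.
rewrite natrM natrX => <-.
by rewrite mulrC mulKf ?subrr// gt_eqF ?ratio_gt0R.
Qed.

Lemma sum_chi0 c : \sum_(f <- elems 0) (chi f == c)%:R = (1 == c)%:R :> R.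
Proof. by rewrite elems0 big_seq1 chi1. Qed.

Lemma chiX_values p e : in_system p -> chi p ^+ e \in values S.
Proof. by move=> pS; rewrite -chiX// chi_values// memX. Qed.

(** Sums deg f over the f of degree n with chi f = c. In the expansion a prime
    power of degree n has cofactor 1, which forces its character value; for a
    smaller one the number of cofactors does not depend on their prescribed
    character value, by equidistribution. *)
Lemma degree_identity n c : (0 < n <= N)%N -> c \in values S ->
  n%:R * (Q ^+ n / D) =
  LamC c n + \sum_(1 <= i < n) Lam i * (Q ^+ (n - i) / D).
Proof.
move=> /andP[n0 nN] cV; rewrite -(sum_chi n0 cV) mulr_sumr.
have -> : \sum_(f <- elems n) n%:R * (chi f == c)%:R =
    \sum_(f <- elems n) (additive_extension S N id f)%:R * (chi f == c)%:R :> R.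
  apply: eq_big_seq => f; rewrite elemsE => /andP[fS /eqP fn].
  by rewrite additive_extension_deg// fn.
rewrite sum_additive_extension.
have -> : \sum_(1 <= i < n) Lam i * (Q ^+ (n - i) / D) =
    \sum_(1 <= i < n) prime_power_sum (fun d p e =>
      (Q ^+ (n - i) / D) * ((e * d == i)%N%:R * d%:R)).
  by apply: eq_bigr => i _; rewrite mulrC prime_power_sumMl.
rewrite exchange_prime_power_sum -prime_power_sumD.
apply: eq_prime_power_sum => d p e /and4P[/andP[d0 dN] pp /eqP pd /andP[e0 eN]].
have pS := prime_mem pp.
have ed0 : (0 < e * d)%N by rewrite muln_gt0 e0.
have chip0 : chi p ^+ e != 0 by rewrite -chiX// chi_neq0// memX.
have chiE k : \sum_(f <- elems k) (chi (p ^+ e * f)%R == c)%:R =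
    \sum_(f <- elems k) (chi f == (c / chi p ^+ e)%R)%:R :> R.
  apply: eq_big_seq => f; rewrite elemsE => /andP[fS _].
  rewrite chiM ?memX// chiX//; congr (nat_of_bool _)%:R.
  by apply/eqP/eqP => [<-|->]; rewrite mulrC ?mulKf ?divfK.
have [edn|ned|edn] := ltngtP (e * d)%N n; last 1 first.
- rewrite edn subnn chiE sum_chi0/= big_nat big1 ?addr0; last first.
    by move=> i /andP[i0 ni]; rewrite gtn_eqF//= mul0r mulr0.
  rewrite mulrC; congr ((nat_of_bool _)%:R * _).
  by apply/eqP/eqP => [h|<-]; [rewrite -[LHS]mul1r h divfK|rewrite divff].
- rewrite chiE sum_chi ?subn_gt0// ?values_div ?chiX_values//=.
  rewrite mul0r add0r (bigD1_seq (e * d)%N) ?iota_uniq ?mem_index_iota ?ed0//=.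
  rewrite eqxx mul1r mulrC big1 ?addr0// => i /negPf.
  by rewrite eq_sym => -> /=; rewrite mul0r mulr0.
- rewrite mulr0 mul0r add0r big_nat big1// => i /andP[i0 ni].
  by rewrite gtn_eqF ?(ltn_trans ni)//= mul0r mulr0.
Qed.

Local Notation g := (#|values S|%:R : R).

Lemma sum_LamC n : \sum_(c in values S) LamC c n = Lam n.
Proof.
rewrite /LamC exchange_prime_power_sum; apply: eq_prime_power_sum => d p e.
move=> /and4P[_ /prime_mem pS _ _]; rewrite -mulr_suml; congr (_ * _).
rewrite (bigD1 (chi p ^+ e)) ?chiX_values//= eqxx andbT big1 ?addr0// => c.
by move=> /andP[_ /negPf]; rewrite eq_sym => ->; rewrite andbF.
Qed.

Lemma values_gt0 : 0 < g.
Proof.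
rewrite ltr0n card_gt0; apply/set0Pn.
by exists (chi 1); apply/chi_values/mem1.
Qed.

(** [degree_identity] expresses [LamC c n] through quantities that do not
    depend on c. *)
Lemma LamC_uniform n c : (0 < n <= N)%N -> c \in values S ->
  LamC c n = Lam n / g.
Proof.
move=> nN cV; have g0 := values_gt0.
apply/(@mulIf _ g); rewrite ?gt_eqF// divfK ?gt_eqF//.
rewrite -sum_LamC mulr_natr -sumr_const; apply: eq_bigr => b bV.
apply: (addIr (\sum_(1 <= i < n) Lam i * (Q ^+ (n - i) / D))).
by rewrite -!degree_identity.
Qed.

Lemma linear_recurrence (l : nat -> R) t n :
  (forall k, (0 < k <= n)%N -> k%:R * t = l k + t * \sum_(1 <= i < k) l i) ->
  forall k, (0 < k <= n)%N -> l k = 1 - (1 - t) ^+ k.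
Proof.
move=> rec; elim=> // k IH /andP[_ kn].
have := rec k.+1; rewrite kn => /(_ isT).
have [->|k0] := posnP k.
  by rewrite big_geq// mulr0 addr0 mul1r expr1 => <-; ring.
rewrite big_nat_recr//= mulrDr.
have := rec k; rewrite k0 (ltnW kn) => /(_ isT).
move/eqP; rewrite addrC -subr_eq => /eqP <-.
rewrite IH ?k0 1?ltnW// -natr1 exprS => h.
have -> : l k.+1 = (k%:R + 1) * t - (k%:R * t - (1 - (1 - t) ^+ k) +
   t * (1 - (1 - t) ^+ k)) by rewrite h; ring.
by ring.
Qed.

(** Summed over c, [degree_identity] is a recurrence for Lam i / base^i,
    solved by [linear_recurrence] with t = #|values| / ratio. The prime number
    theorem of the system thus follows from the number of its elements. *)
Lemma LamE n : (0 < n <= N)%N -> Lam n = Q ^+ n * (1 - (1 - g / D) ^+ n).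
Proof.
move=> nN; have g0 := values_gt0; have D0 := ratio_gt0R; have Q0 := base_gt0.
have QX i : Q ^+ i != 0 by rewrite expf_neq0// gt_eqF.
apply: (canRL (mulVKf (QX n))); rewrite mulrC.
apply: (@linear_recurrence (fun i => Lam i / Q ^+ i) _ N) nN => k /andP[k0 kN].
have kN' : (0 < k <= N)%N by rewrite k0.
have := degree_identity kN' (chi_values (mem1 S)).
rewrite LamC_uniform ?chi_values ?mem1// => h.
have -> : k%:R * (g / D) = k%:R * (Q ^+ k / D) * (g / Q ^+ k).
  by field; rewrite QX gt_eqF.
rewrite h mulrDl; congr (_ + _); first by field; rewrite QX gt_eqF.
rewrite mulr_suml mulr_sumr; apply: eq_big_nat => i /andP[_ ik].
have -> : Q ^+ k = Q ^+ (k - i) * Q ^+ i by rewrite -exprD subnK// ltnW.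
by field; rewrite !QX gt_eqF.
Qed.

Lemma Lam_le n : (0 < n <= N)%N -> Lam n <= Q ^+ n + 1.
Proof.
move=> nN; rewrite LamE// mulrBr mulr1 lerD2l -mulrN.
have D0 := ratio_gt0R; have Q0 := base_gt0.
apply: le_trans (ler_norm _) _; rewrite normrM normrN !normrX.
rewrite -exprMn exprn_ile1// ?mulr_ge0//.
rewrite -normrM ler_norml.
have -> : Q * (1 - g / D) = (Q * D - g * Q) / D by field; rewrite gt_eqF.
rewrite ler_pdivrMr// ler_pdivlMr// mul1r mulN1r.
have := card_values_le S; rewrite -(ler_nat R) natrD !natrM.
by have := card_values_ge S; rewrite -(ler_nat R) natrD !natrM; lra.
Qed.

Lemma expr_base_ge1 n : 1 <= Q ^+ n.
Proof. by rewrite exprn_ege1// ler1n; have := base_ge2 S; lia. Qed.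

Lemma Lam_le2 n : (0 < n <= N)%N -> Lam n <= 2 * Q ^+ n.
Proof. by move=> /Lam_le; have := expr_base_ge1 n; lra. Qed.

Lemma base_ge2R : 2 <= Q. Proof. by rewrite ler_nat base_ge2. Qed.

Lemma ratio_le_values : D <= 2 * g.
Proof.
have := card_values_ge S; rewrite -(ler_nat R) natrD !natrM => h.
have := base_ge2R; have := ratio_gt0R; have := values_gt0; nra.
Qed.

Lemma values_le_ratio : g <= 2 * D.
Proof.
have := card_values_le S; rewrite -(ler_nat R) natrD !natrM => h.
have := base_ge2R; have := ratio_gt0R; have := values_gt0; nra.
Qed.

Lemma LamC_le n c : (0 < n <= N)%N -> c \in values S ->
  LamC c n <= 4 * Q ^+ n / D.
Proof.
move=> nN cV; rewrite LamC_uniform//.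
have D0 := ratio_gt0R; have g0 := values_gt0.
rewrite ler_pdivrMr// mulrAC ler_pdivlMr//.
apply: le_trans (ler_wpM2r (ltW D0) (Lam_le2 nN)) _.
have := ratio_le_values; have := expr_base_ge1 n; nra.
Qed.

Lemma size_primes_of_deg d : (0 < d <= N)%N ->
  (size (primes_of_deg d))%:R * d%:R <= Lam d.
Proof.
move=> /andP[d0 dN].
rewrite /Lam /prime_power_sum (bigD1_seq d) ?iota_uniq ?mem_index_iota ?d0//=.
apply: ler_wpDr.
  by do 3!apply: sumr_ge0 => ? _; rewrite mulr_ge0 ?ler0n.
rewrite -sum1_size natr_sum mulr_suml; apply: ler_sum => p _.
rewrite big_ltn// ?mul1n ?eqxx ?ler_wpDr//; last by lia.
by apply: sumr_ge0 => ? _; rewrite mulr_ge0 ?ler0n.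
Qed.

End PrimePowerSums.

(** * Elements with a given number of small prime factors *)

Section Numeric.
Variable R : realType.

Lemma harmonic_bound K : (0 < K)%N ->
  \sum_(1 <= d < K.+1) (d%:R^-1 * (1 + 5 / d%:R)) <= mean_bound R K.
Proof.
rewrite /mean_bound => K0.
(* the sum of 5 / d^2 is compared with the telescoping sum of
   5 / (d - 1) - 5 / d *)
suff : \sum_(1 <= d < K.+1) (d%:R^-1 * (1 + 5 / d%:R)) <=
    ln K%:R + 11%:R - 5 / K%:R :> R.
  by move/le_trans; apply; rewrite gerBl divr_ge0.
case: K K0 => // K _; elim: K => [|K IH].
  by rewrite big_nat1 invr1 ln1 mulr1; lra.
rewrite big_nat_recr//=.
apply: le_trans (lerD IH (lexx _)) _.
set x := K.+1%:R; set y := K.+2%:R.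
have x0 : 0 < x :> R by rewrite ltr0n.
have y0 : 0 < y :> R by rewrite ltr0n.
have yx : y = x + 1 by rewrite /y -natr1.
clearbody x y.
have lnxy : y^-1 <= ln y - ln x :> R.
  rewrite -ln_div ?posrE// -[ln _]opprK -lnV ?posrE ?divr_gt0// invf_div.
  have -> : x / y = 1 + - y^-1.
    have -> : x = y - 1 by rewrite yx addrK.
    by field; rewrite gt_eqF.
  rewrite lerNr; apply: le_ln1Dx.
  by rewrite ltrN2 invf_lt1// yx ltrDr.
have : 5 / y * y^-1 <= 5 / x - 5 / y :> R.
  have -> : 5 / x - 5 / y = 5 / y * x^-1 * (y - x) by field; rewrite !gt_eqF.
  rewrite yx addrAC subrr add0r mulr1 -yx.
  rewrite ler_wpM2l// ?divr_ge0 ?(ltW y0)//.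
  by rewrite lef_pV2 ?posrE// yx lerDl.
by rewrite mulrDr mulr1 [y^-1 * _]mulrC; lra.
Qed.

Lemma geometric_sum_le (x : R) n : 0 <= x -> x < 1 ->
  \sum_(0 <= i < n) x ^+ i <= (1 - x)^-1.
Proof.
move=> x0 x1; have x1' : 0 < 1 - x by rewrite subr_gt0.
rewrite -[leRHS]mul1r ler_pdivlMr// mulrC.
rewrite -opprB mulNr big_mkord -subrX1 opprB gerBl exprn_ge0//.
Qed.

Lemma shift_sum_le (Q : R) (T : nat -> R) a M : 0 < Q -> (forall n, 0 <= T n) ->
  \sum_(0 <= n < M) (if (a <= n)%N then T (n - a)%N else 0) / Q ^+ n <=
  (\sum_(0 <= n < M) T n / Q ^+ n) / Q ^+ a.
Proof.
move=> Q0 T0.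
have Qn k : 0 <= Q ^+ k by rewrite exprn_ge0 ?ltW.
have pos k : 0 <= T k / Q ^+ k by rewrite divr_ge0.
have [aM|Ma] := leqP a M; last first.
  rewrite big_nat big1 => [|n /andP[_ nM]].
    by rewrite divr_ge0// sumr_ge0.
  by rewrite leqNgt (ltn_trans nM Ma) mul0r.
rewrite (big_cat_nat (leq0n a) aM)/= big_nat big1 ?add0r; last first.
  by move=> n /andP[_ na]; rewrite leqNgt na mul0r.
rewrite -{1}[a]add0n big_addn.
apply: le_trans (_ : (\sum_(0 <= n < M - a) T n / Q ^+ n) / Q ^+ a <= _).
  rewrite mulr_suml; apply: ler_sum => n _; rewrite leq_addl addnK exprD.
  by rewrite invfM mulrA.
rewrite ler_wpM2r ?invr_ge0//.
by rewrite [leRHS](big_cat_nat (leq0n (M - a)%N) (leq_subr _ _))/= lerDl sumr_ge0.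
Qed.

Lemma shift_sum_ge (Q : R) (T : nat -> R) a M k :
  0 < Q -> (forall n, 0 <= T n) -> (a <= k)%N ->
  (\sum_(0 <= n < M) T n / Q ^+ n) / Q ^+ a <=
  \sum_(0 <= n < M + k) (if (a <= n)%N then T (n - a)%N else 0) / Q ^+ n.
Proof.
move=> Q0 T0 ak.
have Qn i : 0 <= Q ^+ i by rewrite exprn_ge0 ?ltW.
have pos n : 0 <= (if (a <= n)%N then T (n - a)%N else 0) / Q ^+ n.
  by rewrite divr_ge0//; case: ifP.
rewrite (big_cat_nat (leq0n a) (leq_trans ak (leq_addl _ _)))/=.
rewrite ler_wpDl ?sumr_ge0//.
rewrite (big_cat_nat (leq_addl M a) (_ : (M + a <= M + k)%N))/=; last first.
  by rewrite leq_add2l.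
rewrite ler_wpDr ?sumr_ge0// -{2}[a]add0n big_addn addnK mulr_suml.
apply: ler_sum => n _; rewrite leq_addl addnK exprD.
by rewrite invfM mulrA.
Qed.

End Numeric.

Section Layers.
Variables (R : realType) (F : finFieldType) (S : factor_system F) (N K : nat).
Local Notation in_system := (in_system S).
Local Notation deg := (deg S).
Local Notation elems := (elems S).
Local Notation chi := (chi S).
Local Notation primes_of_deg := (primes_of_deg S).
Local Notation Q := ((base S)%:R : R).
Local Notation D := ((ratio S)%:R : R).
Local Notation l := (mean_bound R K).
Implicit Types (f g p s t : {poly F}) (n d e i j M : nat) (c : F).
Hypothesis K_gt0 : (0 < K)%N.
Hypothesis K_le_N : (K <= N)%N.

Let Q0 : 0 < Q. Proof. exact: base_gt0. Qed.
Let D0 : 0 < D. Proof. exact: ratio_gt0R. Qed.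
Let QX0 n : 0 < Q ^+ n. Proof. by rewrite exprn_gt0. Qed.
Let QXge0 n : 0 <= Q ^+ n. Proof. exact: ltW. Qed.

Definition Omega f : nat := additive_extension S N (fun d => (d <= K)%N) f.

Lemma Omega_mul_prime_power p e f :
  prime_elem S p -> in_system f -> (e * deg p + deg f <= N)%N ->
  Omega (p ^+ e * f) = (e * (deg p <= K) + Omega f)%N.
Proof.
move=> pp fS; have pS := prime_mem pp.
elim: e => [|e IH] degN; first by rewrite expr0 mul1r.
have memXf : in_system (p ^+ e * f) by rewrite memM ?memX.
rewrite exprS -mulrA /Omega additive_extension_mul_prime//; last first.
  by rewrite !degM ?memX// degX// addnA -mulSn.
by rewrite -/(Omega _) IH; [rewrite mulSn addnA|lia].
Qed.

Lemma Omega_gt0 p t : prime_elem S p -> (deg p <= K)%N -> in_system t ->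
  (deg t <= N)%N -> p %| t -> (0 < Omega t)%N.
Proof.
move=> pp pK tS tN /(mem_dvdP (prime_mem pp) tS)[h hS tE].
rewrite tE /Omega additive_extension_mul_prime// ?pK//.
by rewrite -tE.
Qed.

(** Summing over the degree makes the induction on j work with bounds
    independent of the degrees of the primes removed. *)
Definition layer j M : R :=
  \sum_(0 <= n < M) (\sum_(f <- elems n) (Omega f == j)%:R) / Q ^+ n.

Lemma layer_ge0 j M : 0 <= layer j M.
Proof.
apply: sumr_ge0 => n _; rewrite divr_ge0 ?QXge0//.
by apply: sumr_ge0 => f _; rewrite ler0n.
Qed.

(** Counts the pairs of an f in the layer and a prime power p^e dividing f
    with deg p <= K; there are Omega f = j of them for each f, and the
    cofactor of p^e has j - e small prime factors. *)
Lemma layer_recurrence j M : (M <= N.+1)%N ->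
  j%:R * layer j M <=
  prime_power_sum S N (fun d _ e =>
    ((d <= K) && (e <= j))%N%:R / Q ^+ (e * d) * layer (j - e) M).
Proof.
move=> MN.
have -> : j%:R * layer j M = \sum_(0 <= n < M) prime_power_sum S N
   (fun d p e => (d <= K)%N%:R * ((if (e * d <= n)%N then
      \sum_(f <- elems (n - e * d)) (Omega (p ^+ e * f) == j)%:R else 0)
     / Q ^+ n)).
  rewrite mulr_sumr; apply: eq_big_nat => n _.
  have -> : j%:R * ((\sum_(f <- elems n) (Omega f == j)%:R) / Q ^+ n) =
     (Q ^+ n)^-1 * \sum_(f <- elems n) (Omega f)%:R * (Omega f == j)%:R.
    rewrite mulrA [RHS]mulrC; congr (_ * _).
    rewrite mulr_sumr; apply: eq_bigr => f _.
    by have [->|] := eqVneq (Omega f) j; rewrite ?mulr0.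
  rewrite sum_additive_extension prime_power_sumMl.
  apply: eq_prime_power_sum => d p e _; rewrite mulrC -mulrA.
  by [].
rewrite exchange_prime_power_sum; apply: ler_prime_power_sum => d p e.
move=> /and4P[/andP[d0 dN] pp /eqP pd /andP[e0 eN]]; rewrite -mulr_sumr.
have [dK|dK] := leqP d K; last first.
  by rewrite /= mul0r mulr_ge0 ?layer_ge0 ?divr_ge0 ?QXge0.
rewrite mul1r /=.
pose T n : R := (e <= j)%N%:R * \sum_(f <- elems n) (Omega f == j - e)%N%:R.
have T0 n : 0 <= T n by rewrite mulr_ge0// sumr_ge0// => f _; rewrite ler0n.
apply: le_trans (_ : \sum_(0 <= n < M)
    (if (e * d <= n)%N then T (n - e * d)%N else 0) / Q ^+ n <= _).
  rewrite big_nat [leRHS]big_nat; apply: ler_sum => n /andP[_ nM].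
  rewrite ler_wpM2r ?invr_ge0 ?QXge0//; case: leqP => // edn.
  rewrite /T mulr_sumr big_seq [leRHS]big_seq; apply: ler_sum => f.
  rewrite elemsE => /andP[fS /eqP fn].
  rewrite Omega_mul_prime_power// pd ?dK ?muln1; last by rewrite fn; lia.
  rewrite -natrM ler_nat mulnb; case: eqP => // <-.
  by rewrite leq_addr addKn eqxx.
apply: le_trans (shift_sum_le _ _ Q0 T0) _.
rewrite [leRHS]mulrAC ler_wpM2r ?invr_ge0 ?QXge0//.
rewrite /layer mulr_sumr; apply: ler_sum => n _.
by rewrite /T mulrA.
Qed.

(** There are at most (base^d + 1) / d primes of degree d, and the sum over e
    is geometric with ratio at most 3/4. The factor (3/2)^(e-1) is the loss in
    [weight_shift]. *)
Lemma mean_prime_powers :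
  prime_power_sum S N (fun d _ e =>
    (d <= K)%N%:R / Q ^+ (e * d) * (3 / 2) ^+ e.-1) <= l.
Proof.
apply: le_trans (harmonic_bound R K_gt0).
have bpos d : 0 <= d%:R^-1 * (1 + 5 / d%:R) :> R.
  by rewrite mulr_ge0 ?invr_ge0 ?addr_ge0 ?divr_ge0.
rewrite /prime_power_sum (big_cat_nat (ltn0Sn K) (_ : (K < N.+1)%N))//=.
rewrite [X in _ + X]big_nat [X in _ + X]big1 ?addr0; last first.
  move=> d /andP[Kd _]; rewrite big1// => p _; rewrite big1// => e _.
  by rewrite leqNgt Kd !mul0r.
rewrite big_nat [leRHS]big_nat; apply: ler_sum => d /andP[d0 dK].
have dR0 : 0 < d%:R :> R by rewrite ltr0n.
have dN : (0 < d <= N)%N by rewrite d0 (leq_trans _ K_le_N).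
have Qd : d%:R + 1 <= Q ^+ d.
  apply: le_trans (_ : 2 ^+ d <= _).
    by rewrite natr1 -natrX ler_nat ltn_expl.
  by rewrite lerXn2r ?nnegrE// base_ge2R.
have d1 : 1 <= d%:R :> R by rewrite ler1n.
have inner : \sum_(1 <= e < N.+1)
    (d <= K)%N%:R / Q ^+ (e * d) * (3 / 2) ^+ e.-1 <= (Q ^+ d - 3 / 2)^-1.
  rewrite -ltnS dK big_add1/=.
  have -> : \sum_(0 <= i < N) true%:R / Q ^+ (i.+1 * d) * (3 / 2) ^+ i =
    (Q ^+ d)^-1 * \sum_(0 <= i < N) ((3 / 2) / Q ^+ d) ^+ i.
    rewrite mulr_sumr; apply: eq_bigr => i _.
    rewrite mulSn exprD [(i * d)%N]mulnC exprM invfM.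
    set x := Q ^+ d; set z := 3 / 2.
    by rewrite [(z / x) ^+ i]expr_div_n mul1r; ring.
  rewrite mulrC ler_pdivrMr//.
  apply: le_trans (geometric_sum_le _ _ _) _.
  - by rewrite divr_ge0 ?QXge0//; lra.
  - by rewrite ltr_pdivrMr//; lra.
  have -> : 1 - 3 / 2 / Q ^+ d = (Q ^+ d - 3 / 2) / Q ^+ d.
    by rewrite mulrBl divff ?gt_eqF.
  by rewrite invf_div mulrC.
apply: le_trans (_ : (size (primes_of_deg d))%:R * (Q ^+ d - 3 / 2)^-1 <= _).
  rewrite -sum1_size natr_sum mulr_suml; apply: ler_sum => p _.
  by rewrite mul1r inner.
have x0 : 0 < Q ^+ d - 3 / 2 by lra.
rewrite ler_pdivrMr// mulrAC -mulrA ler_pdivlMl//.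
have := size_primes_of_deg R S dN.
rewrite mulrC => h; apply: le_trans h _; apply: le_trans (Lam_le R S dN) _.
have -> : (Q ^+ d - 3 / 2) * (1 + 5 / d%:R) =
  Q ^+ d - 3 / 2 + 5 * (Q ^+ d - 3 / 2) / d%:R by ring.
have : 5 / 2 <= 5 * (Q ^+ d - 3 / 2) / d%:R by rewrite ler_pdivlMr//; lra.
lra.
Qed.

(** The Hardy-Ramanujan inequality. The division by j in each application of
    [layer_recurrence] produces the factorial. *)
Lemma layer_le_weight j M : (M <= N.+1)%N ->
  layer j M <= layer 0 M * weight l j.
Proof.
move=> MN; have l00 : 0 <= layer 0 M by apply: layer_ge0.
have [n] := ubnP j; elim: n j => // n IH [|j] jn; first by rewrite mulr1.
have jR0 : 0 < j.+1%:R :> R by rewrite ltr0n.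
rewrite -(ler_pM2l jR0).
apply: le_trans (layer_recurrence j.+1 MN) _.
apply: le_trans (_ : layer 0 M * weight l j * l <= _); last first.
  rewrite mulrCA -[leLHS]mulrA ler_wpM2l//= [leRHS]mulrCA.
  rewrite ler_wpM2l ?weight_ge0//.
  by rewrite -ler_pdivrMl// mulrC le_max lexx.
apply: le_trans (ler_wpM2l _ mean_prime_powers); last first.
  by rewrite mulr_ge0 ?weight_ge0.
rewrite prime_power_sumMl; apply: ler_prime_power_sum => d p e.
move=> /and4P[_ _ _ /andP[e0 _]].
have pos : 0 <= (d <= K)%N%:R / Q ^+ (e * d) by rewrite divr_ge0 ?QXge0.
have w0 := weight_ge0 l j.
have [ej|ej] := leqP e j.+1; last first.
  rewrite andbF !mul0r; apply: mulr_ge0; first exact: mulr_ge0.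
  by apply: mulr_ge0 => //; rewrite exprn_ge0//; lra.
rewrite andbT mulrCA ler_wpM2l//.
apply: le_trans (IH (j.+1 - e)%N _) _; first by lia.
rewrite -[leRHS]mulrA ler_wpM2l//.
have -> : (j.+1 - e = j - e.-1)%N by lia.
by rewrite mulrC weight_shift//; lia.
Qed.

Lemma size_elems n : (0 < n)%N ->
  (size (elems n))%:R = #|values S|%:R / D * Q ^+ n.
Proof.
move=> n0; rewrite -sum1_size natr_sum.
have -> : \sum_(f <- elems n) 1 =
    \sum_(c in values S) \sum_(f <- elems n) (chi f == c)%:R :> R.
  rewrite exchange_big/=; apply: eq_big_seq => f.
  rewrite elemsE => /andP[fS _].
  rewrite (bigD1 (chi f)) ?chi_values//= eqxx big1 ?addr0// => c.
  by rewrite eq_sym => /andP[_ /negPf->].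
rewrite (eq_bigr (fun=> Q ^+ n / D)); last by move=> c cV; rewrite sum_chi.
rewrite sumr_const -mulr_natl; ring.
Qed.

Lemma coprime_small_rough s t : in_system s -> (deg s <= K)%N -> in_system t ->
  (deg t <= N)%N -> Omega t = 0%N -> coprimep s t.
Proof.
move=> sS sK tS tN t0; apply/negPn/negP => /(mem_common sS tS).
case=> d [dS d1 ds dt]; have [p pp pd] := exists_prime_dvd dS d1.
have pS := prime_mem pp.
have : (0 < Omega t)%N.
  apply: (Omega_gt0 pp) => //; last exact: dvdp_trans dt.
  by apply: leq_trans sK; apply: mem_dvd_deg => //; apply: dvdp_trans ds.
by rewrite t0.
Qed.

(** Call t rough if Omega t = 0. Each of s and s' is coprime to the rough
    cofactor of the other, hence they divide each other. *)
Lemma small_rough_unique s s' f : in_system s -> in_system s' -> in_system f ->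
  (deg s <= K)%N -> (deg s' <= K)%N -> (deg f <= N)%N ->
  s %| f -> s' %| f -> Omega (f %/ s) = 0%N -> Omega (f %/ s') = 0%N -> s = s'.
Proof.
move=> sS s'S fS sK s'K fN /(mem_dvdP sS fS)[t tS fE].
move=> /(mem_dvdP s'S fS)[t' t'S fE'].
rewrite {1}fE mulKp ?(mem_neq0 sS)// => t0.
rewrite fE' mulKp ?(mem_neq0 s'S)// => t'0.
have tN : (deg t <= N)%N by move: fN; rewrite fE degM//; lia.
have t'N : (deg t' <= N)%N by move: fN; rewrite fE' degM//; lia.
apply/eqP; rewrite -eqp_monic ?(mem_monic sS) ?(mem_monic s'S)//.
apply/andP; split.
  rewrite -(Gauss_dvdpl _ (coprime_small_rough sS sK t'S t'N t'0)).
  by rewrite -fE' fE dvdp_mulr.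
rewrite -(Gauss_dvdpl _ (coprime_small_rough s'S s'K tS tN t0)).
by rewrite -fE fE' dvdp_mulr.
Qed.

(** The upper bound sieve in its simplest form: the products s * t with s of
    degree from 1 to K and t rough of degree less than M are distinct and of
    degree less than M + K. The densities of the s add up to about K, those of
    all products to at most about M + K. *)
Lemma layer0_bound M : (K <= M)%N -> (M + K <= N.+1)%N ->
  layer 0 M <= 8 * M%:R / K%:R.
Proof.
move=> KM MKN.
have KR0 : 0 < K%:R :> R by rewrite ltr0n.
have g0 : 0 < #|values S|%:R :> R by apply: values_gt0.
have tau_ge : 1 / 2 <= #|values S|%:R / D.
  by rewrite ler_pdivlMr//; have := ratio_le_values R S; lra.
have tau_le : #|values S|%:R / D <= 2.
  by rewrite ler_pdivrMr//; have := values_le_ratio R S; lra.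
have l0 : 0 <= layer 0 M by apply: layer_ge0.
have products : \sum_(1 <= a < K.+1) \sum_(s <- elems a) (Q ^+ a)^-1 * layer 0 M
    <= \sum_(0 <= n < M + K) (size (elems n))%:R / Q ^+ n.
  apply: le_trans (_ : \sum_(1 <= a < K.+1) \sum_(s <- elems a)
     \sum_(0 <= n < M + K)
      (\sum_(f <- elems n) ((s %| f)%R && (Omega (f %/ s)%R == 0%N))%:R)
       / Q ^+ n <= _).
    rewrite big_nat [leRHS]big_nat; apply: ler_sum => a /andP[a0 aK].
    rewrite big_seq [leRHS]big_seq; apply: ler_sum => s.
    rewrite elemsE => /andP[sS /eqP sa].
    have multE n : \sum_(f <- elems n) ((s %| f)%R && (Omega (f %/ s)%R == 0%N))%:R
       = if (a <= n)%N then \sum_(f <- elems (n - a)) (Omega f == 0%N)%:R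
         else 0 :> R.
      rewrite -sa -(eq_bigr _ (fun f _ => congr1 (fun g => (Omega g == 0%N)%:R)
           (mulKp f (mem_neq0 sS)))).
      rewrite -(sum_multiples (fun f => (Omega (f %/ s)%R == 0%N)%:R) n sS).
      rewrite [RHS]big_mkcond; apply: eq_bigr => f _.
      by case: (s %| f).
    rewrite (eq_bigr (fun n => (if (a <= n)%N then
      \sum_(f <- elems (n - a)) (Omega f == 0%N)%:R else 0) / Q ^+ n)); last first.
      by move=> n _; rewrite multE.
    rewrite mulrC; apply: (shift_sum_ge (T := fun n =>
      \sum_(f <- elems n) (Omega f == 0%N)%:R)) => // n.
    by apply: sumr_ge0 => f _; rewrite ler0n.
  rewrite (eq_bigr (fun a => \sum_(0 <= n < M + K) \sum_(f <- elems n)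
    \sum_(s <- elems a) ((s %| f)%R && (Omega (f %/ s)%R == 0%N))%:R / Q ^+ n));
    last first.
    move=> a _; rewrite exchange_big/=; apply: eq_bigr => n _.
    rewrite [RHS]exchange_big/=; apply: eq_bigr => s _.
    by rewrite mulr_suml.
  rewrite exchange_big/= big_nat [leRHS]big_nat.
  apply: ler_sum => n /andP[_ nMK].
  rewrite exchange_big/= -sum1_size natr_sum mulr_suml.
  rewrite big_seq [leRHS]big_seq; apply: ler_sum => f.
  rewrite elemsE => /andP[fS /eqP fn].
  rewrite (eq_bigr (fun a => (\sum_(s <- elems a)
     ((s %| f)%R && (Omega (f %/ s)%R == 0%N))%:R) / Q ^+ n)); last first.
    by move=> a _; rewrite mulr_suml.
  rewrite -mulr_suml ler_wpM2r ?invr_ge0 ?QXge0//.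
  have fN : (deg f <= N)%N by rewrite fn -ltnS (leq_trans nMK).
  have [/hasP[a0 a0K /hasP[s0 s0a /andP[s0f /eqP s0r]]]|none] := boolP (has
     (fun a => has (fun s => (s %| f)%R && (Omega (f %/ s)%R == 0%N)) (elems a))
     (index_iota 1 K.+1)); last first.
    rewrite big_seq big1// => a aK; rewrite big_seq big1// => s sa.
    case: (boolP (_ && _)) => // sP; case/negP: none.
    by apply/hasP; exists a => //; apply/hasP; exists s.
  move: s0a; rewrite elemsE => /andP[s0S /eqP s0a].
  move: a0K; rewrite mem_index_iota => a0K.
  apply: le_trans (_ : \sum_(1 <= a < K.+1) (a == a0)%:R <= _); last first.
    rewrite (bigD1_seq a0) ?iota_uniq ?mem_index_iota//= eqxx big1 ?addr0//.
    by move=> a /negPf->.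
  rewrite big_nat [leRHS]big_nat; apply: ler_sum => a /andP[_ aK].
  apply: le_trans (_ : \sum_(s <- elems a) ((s == s0) && (a == a0))%:R <= _).
    rewrite big_seq [leRHS]big_seq; apply: ler_sum => s.
    rewrite elemsE => /andP[sS /eqP sa]; rewrite ler_nat.
    case: (boolP (_ && _)) => // /andP[sf /eqP sr].
    have ss0 : s = s0.
      by apply: (small_rough_unique sS s0S fS) => //; rewrite ?sa ?s0a -ltnS//;
         case/andP: a0K.
    by rewrite ss0 eqxx -s0a -sa ss0 eqxx.
  have [aa0|] := eqVneq a a0; last first.
    by move=> _; rewrite big1// => s _; rewrite andbF.
  rewrite (bigD1_seq s0) ?elems_uniq//= ?elemsE ?s0S ?aa0 ?s0a ?eqxx//=.
  by rewrite big1 ?addr0// => s /negPf->.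
have lower : K%:R / 2 * layer 0 M <=
    \sum_(1 <= a < K.+1) \sum_(s <- elems a) (Q ^+ a)^-1 * layer 0 M.
  have -> : K%:R / 2 * layer 0 M = \sum_(1 <= a < K.+1) (1 / 2 * layer 0 M).
    by rewrite sumr_const_nat subn1/= -mulr_natl; field.
  rewrite big_nat [leRHS]big_nat; apply: ler_sum => a /andP[a0 _].
  have -> : \sum_(s <- elems a) (Q ^+ a)^-1 * layer 0 M =
     (size (elems a))%:R / Q ^+ a * layer 0 M.
    by rewrite -sum1_size natr_sum !mulr_suml; apply: eq_bigr => s _; rewrite mul1r.
  by rewrite ler_wpM2r// size_elems// mulfK// gt_eqF.
have upper : \sum_(0 <= n < M + K) (size (elems n))%:R / Q ^+ n <=
    2 * (M + K)%:R.
  apply: le_trans (_ : \sum_(0 <= n < M + K) 2 <= _); last first.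
    by rewrite sumr_const_nat subn0 mulr_natr.
  apply: ler_sum => -[|n] _; first by rewrite elems0 expr0 divr1/= ler1n.
  by rewrite size_elems// mulfK// gt_eqF.
have := le_trans lower (le_trans products upper).
rewrite natrD => h; rewrite ler_pdivlMr//.
have : K%:R <= M%:R :> R by rewrite ler_nat.
lra.
Qed.

End Layers.

(** * Elements with a given character and number of small prime factors *)

Section ConstrainedLayers.
Variables (R : realType) (F : finFieldType) (S : factor_system F) (N K : nat).
Local Notation in_system := (in_system S).
Local Notation deg := (deg S).
Local Notation elems := (elems S).
Local Notation chi := (chi S).
Local Notation primes_of_deg := (primes_of_deg S).
Local Notation Q := ((base S)%:R : R).
Local Notation D := ((ratio S)%:R : R).
Local Notation l := (mean_bound R K).
Local Notation layer := (@layer R F S N K).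
Local Notation Omega := (@Omega F S N K).
Implicit Types (f g p s t : {poly F}) (n d e i j M : nat) (b c : F).
Hypothesis K_gt0 : (0 < K)%N.
Hypothesis K_le_N : (K <= N)%N.

Let Q0 : 0 < Q. Proof. exact: base_gt0. Qed.
Let D0 : 0 < D. Proof. exact: ratio_gt0R. Qed.
Let QX0 n : 0 < Q ^+ n. Proof. by rewrite exprn_gt0. Qed.
Let QXge0 n : 0 <= Q ^+ n. Proof. exact: ltW. Qed.

(** For e = 1 this is the bound for [LamC]. For e > 1 the condition on the
    character is dropped: there are at most 2 base^(i - e + 1) / d primes of
    the relevant degree d, and the factor base^(e - 1) saved is at least ratio
    * 2^(e - 2). *)
Lemma constrained_exponent_le e i b :
  (0 < e <= N)%N -> (0 < i <= N)%N -> b \in values S ->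
  \sum_(1 <= d < N.+1) \sum_(p <- primes_of_deg d)
     ((e * d == i)%N && (chi p ^+ e == b))%:R * d%:R <=
  8 * (Q ^+ i / D) / 2 ^+ e.
Proof.
move=> /andP[e0 eN] iN bV; case: e e0 eN => // -[|e] _ eN.
  apply: le_trans (_ : LamC R S N b i <= _).
    apply: ler_sum => d _; apply: ler_sum => p _.
    by rewrite [leRHS]big_ltn//= lerDl sumr_ge0// => e _; rewrite mulr_ge0.
  apply: le_trans (LamC_le R iN bV) _.
  have : 0 <= Q ^+ i / D by rewrite divr_ge0 ?QXge0 ?ler0n.
  by rewrite -mulrA; lra.
have rhs0 : 0 <= 8 * (Q ^+ i / D) / 2 ^+ e.+2.
  by rewrite !mulr_ge0 ?QXge0 ?invr_ge0 ?exprn_ge0 ?ler0n.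
have [/hasP[d0]|none] := boolP (has (fun d => e.+2 * d == i)%N (index_iota 1 N.+1));
    last first.
  rewrite big_seq big1// => d dN; rewrite big1// => p _.
  have [ed|] := eqVneq (e.+2 * d)%N i; last by rewrite mul0r.
  by case/hasP: none; exists d; rewrite ?ed.
rewrite mem_index_iota => d0N /eqP d0i.
apply: le_trans (_ : (size (primes_of_deg d0))%:R * d0%:R <= _).
  rewrite (bigD1_seq d0) ?iota_uniq ?mem_index_iota//=.
  rewrite [X in _ + X]big1 ?addr0 => [|d dd0]; last first.
    rewrite big1// => p _; rewrite -d0i eqn_pmul2l// (negPf dd0).
    by rewrite mul0r.
  rewrite -sum1_size natr_sum mulr_suml; apply: ler_sum => p _.
  by rewrite ler_wpM2r// ler_nat; case: (_ && _).
apply: le_trans (size_primes_of_deg R S d0N) _.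
apply: le_trans (Lam_le2 R S d0N) _.
rewrite ler_pdivlMr ?exprn_gt0// mulrA ler_pdivlMr//.
have ie : (i = d0 + e.+1 * d0)%N by rewrite -d0i mulSn.
have eQ : D * 2 ^+ e <= Q ^+ (e.+1 * d0).
  apply: le_trans (_ : Q ^+ e.+1 <= _); last first.
    apply: ler_weXn2l; first by have := base_ge2R R S; lra.
    by case/andP: d0N => d00 _; rewrite leq_pmulr.
  rewrite exprS; apply: ler_pM => //.
  - by rewrite exprn_ge0.
  - by rewrite ler_nat ratio_le_base.
  - by rewrite lerXn2r ?nnegrE// base_ge2R.
have := ler_wpM2l (QXge0 d0) eQ; rewrite ie exprD !exprS; lra.
Qed.

Lemma constrained_prime_powers_le (a : nat -> R) i b :
  (forall e, 0 <= a e) -> (0 < i <= N)%N -> b \in values S ->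
  prime_power_sum S N (fun d p e =>
    ((e * d == i)%N && (chi p ^+ e == b))%:R * d%:R * a e) <=
  8 * (Q ^+ i / D) * \sum_(1 <= e < N.+1) a e / 2 ^+ e.
Proof.
move=> a0 iN bV; rewrite mulr_sumr.
have -> : prime_power_sum S N (fun d p e =>
    ((e * d == i)%N && (chi p ^+ e == b))%:R * d%:R * a e) =
  \sum_(1 <= e < N.+1) a e * \sum_(1 <= d < N.+1) \sum_(p <- primes_of_deg d)
     ((e * d == i)%N && (chi p ^+ e == b))%:R * d%:R.
  rewrite /prime_power_sum; under eq_bigr do rewrite exchange_big/=.
  rewrite exchange_big/=; apply: eq_bigr => e _; rewrite mulr_sumr.
  apply: eq_bigr => d _; rewrite mulr_sumr; apply: eq_bigr => p _.
  by rewrite mulrC.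
rewrite big_nat [leRHS]big_nat; apply: ler_sum => e eN.
rewrite mulrCA ler_wpM2l//.
exact: constrained_exponent_le.
Qed.

Lemma geometric_shift_sum (w : R) j M n :
  0 <= w -> 0 <= layer 0 M -> 
  (forall e, (e <= j)%N -> layer (j - e) M <= layer 0 M * ((3 / 2) ^+ e * w)) ->
  \sum_(1 <= e < n.+1) (layer j M + (e <= j)%N%:R * layer (j - e) M) / 2 ^+ e <=
  4 * (layer 0 M * w).
Proof.
move=> w0 l0 le_w; set W := layer 0 M * w.
have W0 : 0 <= W by rewrite mulr_ge0.
apply: le_trans (_ : \sum_(1 <= e < n.+1)
    (W * (1 / 2) ^+ e + W * (3 / 4) ^+ e) <= _).
  apply: ler_sum => e _; rewrite mulrDl; apply: lerD.
    rewrite expr_div_n expr1n mul1r ler_wpM2r ?invr_ge0 ?exprn_ge0//.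
    by have := le_w 0%N isT; rewrite subn0 expr0 mul1r.
  have -> : 3 / 4 = (3 / 2) / 2 :> R by field.
  rewrite [(_ / 2) ^+ e]expr_div_n mulrA ler_wpM2r ?invr_ge0 ?exprn_ge0//.
  case: leqP => ej; last by rewrite mul0r mulr_ge0 ?exprn_ge0//; lra.
  by rewrite mul1r /W -mulrA [w * _]mulrC le_w.
rewrite big_split/= -!mulr_sumr !big_add1/=.
have half : \sum_(0 <= i < n) (1 / 2) ^+ i.+1 <= 1 :> R.
  under eq_bigr do rewrite exprS; rewrite -mulr_sumr.
  have : \sum_(0 <= i < n) (1 / 2) ^+ i <= 2 :> R.
    apply: le_trans (geometric_sum_le n _ _) _; try by lra.
    by rewrite -div1r ler_pdivrMr; lra.
  lra.
have quarter : \sum_(0 <= i < n) (3 / 4) ^+ i.+1 <= 3 :> R.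
  under eq_bigr do rewrite exprS; rewrite -mulr_sumr.
  have : \sum_(0 <= i < n) (3 / 4) ^+ i <= 4 :> R.
    apply: le_trans (geometric_sum_le n _ _) _; try by lra.
    by rewrite -div1r ler_pdivrMr; lra.
  lra.
have := ler_wpM2l W0 half; have := ler_wpM2l W0 quarter; lra.
Qed.

Definition constrained_layer c j n : R :=
  \sum_(f <- elems n) ((chi f == c) && (Omega f == j))%:R.

(** Prescribing the character saves the full factor ratio: in the expansion of
    n times the count over prime powers p^e, the cofactor is left free,
    counted by [layer], and the condition falls on p^e, where
    [constrained_exponent_le] applies. *)
Lemma constrained_layer_le c j n : (K <= n)%N -> (n + n <= N)%N ->
  c \in values S ->
  constrained_layer c j n <= 256 * (Q ^+ n / D) * (weight l j / K%:R).
Proof.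
move=> Kn nN cV.
have n0 : (0 < n)%N by rewrite (leq_trans K_gt0).
have nN' : (n <= N)%N by rewrite (leq_trans _ nN)// leq_addr.
have nR0 : 0 < n%:R :> R by rewrite ltr0n.
have KR0 : 0 < K%:R :> R by rewrite ltr0n.
have l0 : 0 <= layer 0 n by apply: layer_ge0.
have QD0 : 0 <= Q ^+ n / D by rewrite divr_ge0 ?QXge0 ?ler0n.
suff bound : n%:R * constrained_layer c j n <=
    8 * (Q ^+ n / D) * (4 * (layer 0 n * weight l j)).
  rewrite -(ler_pM2l nR0); apply: le_trans bound _.
  have nKN : (n + K <= N.+1)%N.
    by rewrite leqW// (leq_trans _ nN)// leq_add2l.
  have l0K := layer0_bound R S K_gt0 K_le_N Kn nKN.
  have -> : n%:R * (256 * (Q ^+ n / D) * (weight l j / K%:R)) =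
    8 * (Q ^+ n / D) * (4 * (8 * n%:R / K%:R * weight l j)) by ring.
  apply: ler_wpM2l; first exact: mulr_ge0.
  by apply: ler_wpM2l => //; apply: ler_wpM2r => //; apply: weight_ge0.
rewrite mulr_sumr.
have -> : \sum_(f <- elems n) n%:R * ((chi f == c) && (Omega f == j))%:R =
    \sum_(f <- elems n) (additive_extension S N id f)%:R *
      ((chi f == c) && (Omega f == j))%:R :> R.
  apply: eq_big_seq => f; rewrite elemsE => /andP[fS /eqP fn].
  by rewrite additive_extension_deg// fn.
rewrite sum_additive_extension.
apply: le_trans (_ : \sum_(0 <= m < n) \sum_(f <- elems m)
   prime_power_sum S N (fun d p e =>
     ((e * d == n - m)%N && (chi p ^+ e == (c / chi f)%R))%:R * d%:R *
     ((Omega f == j)%:R + (Omega f + e == j)%N%:R)) <= _).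
  under eq_bigr do rewrite exchange_prime_power_sum.
  rewrite exchange_prime_power_sum; apply: ler_prime_power_sum => d p e.
  move=> /and4P[/andP[d0 dN] pp /eqP pd /andP[e0 eN]]; have pS := prime_mem pp.
  have pos m f : 0 <= ((e * d == n - m)%N && (chi p ^+ e == (c / chi f)%R))%:R *
     d%:R * ((Omega f == j)%:R + (Omega f + e == j)%N%:R) :> R.
    by rewrite !mulr_ge0 ?addr_ge0 ?ler0n.
  case: leqP => edn; last first.
    by rewrite mulr0 sumr_ge0// => m _; rewrite sumr_ge0.
  have ed0 : (0 < e * d)%N by rewrite muln_gt0 e0.
  rewrite [leRHS](bigD1_seq (n - e * d)%N) ?iota_uniq ?mem_index_iota//=;
    last first.
    by rewrite ltn_subrL ed0.
  rewrite ler_wpDr//; first by rewrite sumr_ge0// => m _; rewrite sumr_ge0.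
  rewrite mulr_sumr big_seq [leRHS]big_seq; apply: ler_sum => f.
  rewrite elemsE => /andP[fS /eqP fn]; rewrite subKn// eqxx/=.
  rewrite chiM ?memX// chiX// [leRHS]mulrAC [leLHS]mulrC.
  apply: ler_wpM2r => //; rewrite -natrD -natrM ler_nat.
  rewrite (Omega_mul_prime_power R K_gt0 K_le_N)//; last first.
    by rewrite pd fn subnKC.
  have -> : (chi p ^+ e == (c / chi f)%R) = (chi p ^+ e * chi f == c).
    have f0 := chi_neq0 fS.
    by apply/eqP/eqP => [->|<-]; rewrite ?divfK ?mulfK.
  case: (_ == c) => //=; rewrite mul1n.
  by case: (_ <= K)%N; rewrite ?muln1 ?muln0 ?add0n ?leq_addr// addnC leq_addl.
apply: le_trans (_ : \sum_(0 <= m < n) \sum_(f <- elems m)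
   8 * (Q ^+ (n - m) / D) * \sum_(1 <= e < N.+1)
     ((Omega f == j)%:R + (Omega f + e == j)%N%:R) / 2 ^+ e <= _).
  rewrite big_nat [leRHS]big_nat; apply: ler_sum => m /andP[_ mn].
  rewrite big_seq [leRHS]big_seq; apply: ler_sum => f.
  rewrite elemsE => /andP[fS _]; apply: constrained_prime_powers_le.
  - by move=> e; rewrite addr_ge0.
  - by rewrite subn_gt0 mn (leq_trans (leq_subr _ _)).
  - by rewrite values_div// chi_values.
have -> : \sum_(0 <= m < n) \sum_(f <- elems m)
   8 * (Q ^+ (n - m) / D) * \sum_(1 <= e < N.+1)
     ((Omega f == j)%:R + (Omega f + e == j)%N%:R) / 2 ^+ e =
   8 * (Q ^+ n / D) * \sum_(1 <= e < N.+1)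
     (layer j n + (e <= j)%N%:R * layer (j - e) n) / 2 ^+ e.
  rewrite [RHS]mulr_sumr.
  transitivity (\sum_(0 <= m < n) \sum_(1 <= e < N.+1)
    8 * (Q ^+ n / D) * (((\sum_(f <- elems m) (Omega f == j)%:R) / Q ^+ m +
      (e <= j)%N%:R * ((\sum_(f <- elems m) (Omega f == j - e)%N%:R) / Q ^+ m))
        / 2 ^+ e)).
    apply: eq_big_nat => m /andP[_ mn].
    under eq_bigr do rewrite mulr_sumr.
    rewrite exchange_big/=; apply: eq_bigr => e _.
    have -> : Q ^+ n = Q ^+ (n - m) * Q ^+ m by rewrite -exprD subnK// ltnW.
    have e2 : 2 ^+ e != 0 :> R by rewrite expf_neq0 ?pnatr_eq0.
    have -> : forall A B C : R, 8 * (Q ^+ (n - m) * Q ^+ m / D) *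
      ((A / Q ^+ m + B * (C / Q ^+ m)) / 2 ^+ e) =
      8 * (Q ^+ (n - m) / D) * ((A + B * C) / 2 ^+ e).
      by move=> A B C; field; rewrite !gt_eqF// exprn_gt0.
    rewrite mulr_sumr -big_split/= mulr_suml mulr_sumr; apply: eq_bigr => f _.
    congr (_ * ((_ + _) / _)); rewrite -natrM mulnb; congr (nat_of_bool _)%:R.
    apply/eqP/andP => [<-|[ej /eqP->]]; last by rewrite subnK.
    by rewrite leq_addl addnK.
  rewrite exchange_big/=; apply: eq_bigr => e _.
  rewrite -mulr_sumr -mulr_suml; congr (_ * (_ / _)).
  by rewrite big_split/= -mulr_sumr.
apply: ler_wpM2l; first exact: mulr_ge0.
apply: geometric_shift_sum => //.
  exact: weight_ge0.
move=> e ej; apply: le_trans (layer_le_weight R S K_gt0 K_le_N _ _) _.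
  by rewrite leqW.
by rewrite ler_wpM2l// weight_shift.
Qed.

End ConstrainedLayers.

(** * Elements with a divisor of given degree *)

Definition count_multiples (F : finFieldType) (S : factor_system F) c n k :=
  count (fun f => (chi S f == c) && has (fun g => g %| f) (elems S k))
    (elems S n).

Section Multiples.
Variables (R : realType) (F : finFieldType) (S : factor_system F) (n k K : nat).
Local Notation in_system := (in_system S).
Local Notation deg := (deg S).
Local Notation elems := (elems S).
Local Notation chi := (chi S).
Local Notation Q := ((base S)%:R : R).
Local Notation D := ((ratio S)%:R : R).
Local Notation N := (n + n)%N.
Local Notation l := (mean_bound R K).
Local Notation Omega := (@Omega F S N K).
Local Notation constrained_layer := (@constrained_layer R F S N K).
Local Notation m := (trunc_log 2 K).
Implicit Types (f g h : {poly F}) (c : F).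
Hypotheses (K_gt0 : (0 < K)%N) (Kk : (K <= k)%N) (Kn : (k + K <= n)%N).

Let Q0 : 0 < Q. Proof. exact: base_gt0. Qed.
Let D0 : 0 < D. Proof. exact: ratio_gt0R. Qed.
Let QXge0 i : 0 <= Q ^+ i. Proof. by rewrite exprn_ge0// ltW. Qed.
Let kn : (k <= n)%N. Proof. exact: leq_trans (leq_addr _ _) Kn. Qed.
Let KN : (K <= N)%N.
Proof. by rewrite (leq_trans Kk)// (leq_trans kn)// leq_addr. Qed.

Lemma Omega_le_deg f : in_system f -> (deg f <= N)%N -> (Omega f <= deg f)%N.
Proof.
move=> fS fN; rewrite -[leqRHS](additive_extension_deg fS fN).
rewrite /Omega /additive_extension big_nat [leqRHS]big_nat.
apply: leq_sum => d /andP[d0 _]; apply: leq_sum => p _.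
by rewrite leq_mul2l; case: (d <= K)%N; rewrite ?d0 orbT.
Qed.

Lemma OmegaM g h : in_system g -> in_system h -> (deg g + deg h <= N)%N ->
  Omega (g * h) = (Omega g + Omega h)%N.
Proof. by move=> gS hS ghN; rewrite /Omega additive_extensionM// degM. Qed.

Lemma count_Omega_large c : c \in values S ->
  \sum_(f <- elems n) ((chi f == c) && (m < Omega f)%N)%:R <=
  256 * (Q ^+ n / D) * (\sum_(m.+1 <= j < n.+1) weight l j) / K%:R.
Proof.
move=> cV.
apply: le_trans (_ : \sum_(m.+1 <= j < n.+1) constrained_layer c j n <= _).
  rewrite exchange_big/= big_seq [leRHS]big_seq; apply: ler_sum => f.
  rewrite elemsE => /andP[fS /eqP fn].
  have fN : (deg f <= N)%N by rewrite fn leq_addr.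
  have Of : (Omega f <= n)%N by rewrite -[leqRHS]fn Omega_le_deg.
  case: (boolP (_ && _)) => [/andP[fc mO]|_]; last first.
    by rewrite sumr_ge0// => j _; rewrite ler0n.
  rewrite (bigD1_seq (Omega f)) ?iota_uniq ?mem_index_iota ?mO ?ltnS//=.
  rewrite fc eqxx lerDl sumr_ge0// => j _; exact: ler0n.
rewrite -mulrA mulr_suml mulr_sumr; apply: ler_sum => j _.
apply: (constrained_layer_le R K_gt0 KN) => //.
by rewrite (leq_trans Kk).
Qed.

(** The pairs (g, h) with g h = f and Omega g + Omega h <= m. Once g is
    chosen, the character of h is prescribed, which saves the factor ratio. *)
Lemma count_pairs_le c : c \in values S ->
  \sum_(g <- elems k) \sum_(f <- elems n | g %| f)
     ((chi f == c) && (Omega f <= m)%N)%:R <=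
  (512%:R * 256%:R) * (Q ^+ n / D) *
  (\sum_(0 <= s < m.+1) \sum_(0 <= j < s.+1) weight l j * weight l (s - j))
   / K%:R ^+ 2.
Proof.
move=> cV.
have KR0 : 0 < K%:R :> R by rewrite ltr0n.
have kkN : (k + k <= N)%N by apply: leq_add.
have nkN : ((n - k) + (n - k) <= N)%N by apply: leq_add; apply: leq_subr.
have Knk : (K <= n - k)%N by rewrite leq_subRL.
pose P g j : R := (Omega g == j)%:R.
apply: le_trans (_ : \sum_(0 <= s < m.+1) \sum_(0 <= j < s.+1)
   \sum_(g <- elems k) P g j * constrained_layer (c / chi g) (s - j) (n - k) <= _).
  under [leRHS]eq_bigr do rewrite exchange_big/=.
  rewrite exchange_big/= big_seq [leRHS]big_seq; apply: ler_sum => g.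
  rewrite elemsE => /andP[gS /eqP gk].
  rewrite sum_multiples// gk kn.
  under [leRHS]eq_bigr do under eq_bigr do rewrite mulr_sumr.
  under [leRHS]eq_bigr do rewrite exchange_big/=.
  rewrite exchange_big/= big_seq [leRHS]big_seq; apply: ler_sum => h.
  rewrite elemsE => /andP[hS /eqP hn].
  have ghN : (deg g + deg h <= N)%N by rewrite gk hn subnKC// leq_addr.
  have pos s j : 0 <= P g j * ((chi h == (c / chi g)%R) && (Omega h == s - j)%N)%:R.
    by rewrite mulr_ge0 ?ler0n.
  case: (boolP (_ && _)) => [/andP[/eqP ghc]|_]; last first.
    by rewrite sumr_ge0// => s _; rewrite sumr_ge0.
  rewrite OmegaM// => gm.
  rewrite (bigD1_seq (Omega g + Omega h)%N) ?iota_uniq ?mem_index_iota//=.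
  rewrite (bigD1_seq (Omega g)) ?iota_uniq ?mem_index_iota ?ltnS ?leq_addr//=.
  have -> : chi h == (c / chi g)%R.
    by rewrite -ghc chiM// mulrC mulKf ?eqxx// chi_neq0.
  rewrite addKn /P !eqxx mulr1 -addrA lerDl addr_ge0//.
    by rewrite sumr_ge0// => j _; rewrite mulr_ge0 ?ler0n.
  rewrite sumr_ge0// => s _; rewrite sumr_ge0// => j _.
  by rewrite mulr_ge0 ?ler0n.
have layer_k j : \sum_(g <- elems k) P g j <= 512%:R * Q ^+ k * (weight l j / K%:R).
  apply: le_trans (_ : \sum_(b in values S) constrained_layer b j k <= _).
    rewrite exchange_big/= big_seq [leRHS]big_seq; apply: ler_sum => g.
    rewrite elemsE => /andP[gS _].
    by rewrite (bigD1 (chi g)) ?chi_values//= eqxx/= lerDl sumr_ge0.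
  apply: le_trans (_ : \sum_(b in values S)
      256 * (Q ^+ k / D) * (weight l j / K%:R) <= _).
    by apply: ler_sum => b bV; apply: (constrained_layer_le R K_gt0 KN).
  rewrite sumr_const -[leLHS]mulr_natl; set v := #|_|%:R.
  have -> : v * (256 * (Q ^+ k / D) * (weight l j / K%:R)) =
            256 * Q ^+ k * (v / D) * (weight l j / K%:R) by ring.
  have -> : 512%:R * Q ^+ k = 256 * Q ^+ k * 2 by ring.
  apply: ler_wpM2r; first by rewrite divr_ge0 ?weight_ge0.
  apply: ler_wpM2l; first by rewrite mulr_ge0.
  by rewrite ler_pdivrMr//; apply: values_le_ratio.
rewrite -mulrA mulr_suml mulr_sumr; apply: ler_sum => s _.
rewrite mulr_suml mulr_sumr; apply: ler_sum => j _.
apply: le_trans (_ : \sum_(g <- elems k) P g j *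
   (256 * (Q ^+ (n - k) / D) * (weight l (s - j) / K%:R)) <= _).
  rewrite big_seq [leRHS]big_seq; apply: ler_sum => g.
  rewrite elemsE => /andP[gS _]; rewrite ler_wpM2l ?ler0n//.
  by apply: (constrained_layer_le R K_gt0 KN) => //; rewrite values_div// chi_values.
rewrite -mulr_suml.
have w0 := weight_ge0 l (s - j).
have t0 : 0 <= 256 * (Q ^+ (n - k) / D) * (weight l (s - j) / K%:R).
  by rewrite !mulr_ge0 ?invr_ge0 ?ler0n ?QXge0.
apply: le_trans (ler_wpM2r t0 (layer_k j)) _.
have -> : Q ^+ n = Q ^+ k * Q ^+ (n - k) by rewrite -exprD subnKC.
by rewrite le_eqVlt; apply/orP; left; apply/eqP; field; rewrite !gt_eqF.
Qed.

Lemma count_multiples_le c : c \in values S ->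
  (count_multiples S c n k)%:R <=
    \sum_(f <- elems n) ((chi f == c) && (m < Omega f)%N)%:R +
    \sum_(g <- elems k) \sum_(f <- elems n | g %| f)
       ((chi f == c) && (Omega f <= m)%N)%:R :> R.
Proof.
move=> cV; rewrite /count_multiples -sum1_count big_mkcond natr_sum/=.
under [X in _ + X]eq_bigr do rewrite big_mkcond/=.
rewrite [X in _ + X]exchange_big/= -big_split/=; apply: ler_sum => f _.
have pos : 0 <= \sum_(g <- elems k)
    (if g %| f then ((chi f == c) && (Omega f <= m)%N)%:R else 0) :> R.
  by rewrite sumr_ge0// => g _; case: ifP.
case: ifP => [/andP[fc /hasP[g gk gf]]|_]; last by rewrite addr_ge0.
have [Om|Om] := leqP (Omega f) m; last first.
  by rewrite fc/= lerDl sumr_ge0// => h _; case: ifP.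
rewrite andbF add0r fc (bigD1_seq g) ?elems_uniq//= gf lerDl.
by rewrite sumr_ge0// => h _; case: ifP.
Qed.

Lemma count_multiples_large c : c \in values S -> 88%:R <= ln K%:R :> R ->
  (count_multiples S c n k)%:R <=
    ((800%:R * 800%:R) * (expR 20%:R * Num.sqrt 2)) * (Q ^+ n / D * decay R K).
Proof.
move=> cV K88; apply: le_trans (count_multiples_le cV) _.
apply: le_trans (lerD (count_Omega_large cV) (count_pairs_le cV)) _.
have KR0 : 0 < K%:R :> R by rewrite ltr0n.
have tail := weight_tail K88 n.+1; have pairs := weight_pairs K88.
set A := \sum_(m.+1 <= j < _) _ in tail *.
set B := \sum_(0 <= s < _) _ in pairs *.
set X := Q ^+ n / D; have X0 : 0 <= X by rewrite divr_ge0 ?QXge0 ?ler0n.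
have center := weight_center K88; set w := weight l m in tail pairs center.
have w0 : 0 <= w / K%:R by rewrite divr_ge0 ?weight_ge0.
have hA : A / K%:R <= 9 * (w / K%:R) by rewrite mulrA ler_wpM2r ?invr_ge0.
have hB : B / K%:R ^+ 2 <= 4 * (w / K%:R).
  apply: le_trans (ler_wpM2r _ pairs) _; first by rewrite invr_ge0 exprn_ge0.
  by rewrite le_eqVlt; apply/orP; left; apply/eqP; field; rewrite gt_eqF.
have XA := ler_wpM2l X0 hA; have XB := ler_wpM2l X0 hB.
have Xc := ler_wpM2l X0 center; have Xw : 0 <= X * (w / K%:R) by rewrite mulr_ge0.
have -> : 256 * X * A / K%:R = 256 * (X * (A / K%:R)) by ring.
have -> : (512%:R * 256%:R) * X * B / K%:R ^+ 2 =
    512%:R * 256%:R * (X * (B / K%:R ^+ 2)) by ring.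
have -> : (800%:R * 800%:R) * (expR 20%:R * Num.sqrt 2) * (X * decay R K) =
   (800%:R * 800%:R) * (X * (expR 20%:R * Num.sqrt 2 * decay R K)) by ring.
lra.
Qed.

End Multiples.

(** A multiple f of some g of degree k either has more than m small prime
    factors or comes from a pair counted in [count_pairs_le]. When K is
    bounded, the number of all f with chi f = c is a sufficient bound. *)
Theorem count_multiples_bound (R : realType) : exists2 C : R, 0 < C &
  forall (F : finFieldType) (S : factor_system F) (n k K : nat) (c : F),
    (0 < K)%N -> (K <= k)%N -> (k + K <= n)%N -> c \in values S ->
    (count_multiples S c n k)%:R <=
      C * ((base S)%:R ^+ n / (ratio S)%:R * decay R K).
Proof.
have [b b0 lower] := decay_lower_bound (88%:R : R).
set C1 := (800%:R * 800%:R) * (expR 20%:R * Num.sqrt 2) : R.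
have C1_gt0 : 0 < C1 by rewrite !mulr_gt0 ?expR_gt0 ?sqrtr_gt0.
exists (C1 + b^-1); first by rewrite addr_gt0 ?invr_gt0.
move=> F S n k K c K0 Kk Kn cV.
set X := _ / (ratio S)%:R.
have X0 : 0 <= X.
  by rewrite divr_ge0 ?exprn_ge0 ?ler0n.
have dec0 := ltW (decay_gt0 R K0).
have [K88|K88] := leP (88%:R : R) (ln K%:R).
  apply: le_trans (count_multiples_large K0 Kk Kn cV K88) _.
  apply: ler_wpM2r; first exact: mulr_ge0.
  by rewrite -/C1 lerDl invr_ge0 ltW.
have n0 : (0 < n)%N by apply: leq_trans Kn; rewrite addn_gt0 K0 orbT.
apply: le_trans (_ : X <= _).
  rewrite /X -(sum_chi R n0 cV) /count_multiples -sum1_count big_mkcond natr_sum.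
  by apply: ler_sum => f _ /=; case: (_ == c) => //=; case: ifP.
rewrite mulrCA -[leLHS]mulr1 ler_wpM2l//.
have := lower K K0 (ltW K88) => bdec.
rewrite mulrDl; apply: ler_wpDl; first by rewrite mulr_ge0// ltW.
by rewrite ler_pdivlMl// mulr1.
Qed.

(** * Enumeration of monic polynomials *)

Section Monics.
Variable F : finFieldType.
Implicit Types (f g : {poly F}) (n m : nat) (c : F).

Definition monics n : seq {poly F} :=
  [seq val f | f : {poly_n.+1 F} in [pred f | monic_of_degree n (val f)]].

Lemma monics_uniq n : uniq (monics n).
Proof. by rewrite map_inj_uniq ?enum_uniq// => f g; apply: val_inj. Qed.

Lemma monicsE n f : (f \in monics n) = monic_of_degree n f.
Proof.
apply/mapP/idP => [[g + ->]|fn]; first by rewrite mem_enum.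
have sf : f \is a poly_of_size n.+1.
  by rewrite qualifE/=; case/andP: fn => _ /eqP->.
by exists (NPoly sf); rewrite ?mem_enum.
Qed.

(** Sets of polynomials of bounded size are counted through lists of
    polynomials, possibly after an injective transformation. *)
Lemma card_npoly_le m (A : {set {poly_m F}}) (s : seq {poly F})
    (h : {poly F} -> {poly F}) :
  {in A &, injective (fun f : {poly_m F} => h (val f))} ->
  (forall f : {poly_m F}, f \in A -> h (val f) \in s) -> (#|A| <= size s)%N.
Proof.
move=> hinj hs; rewrite cardE -(size_map (fun f : {poly_m F} => h (val f))).
apply: uniq_leq_size => [|_ /mapP[f + ->]]; last by rewrite mem_enum => /hs.
rewrite map_inj_in_uniq ?enum_uniq// => f g; rewrite !mem_enum.
exact: hinj.
Qed.

Lemma card_npoly_ge m (A : {set {poly_m F}}) (s : seq {poly F})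
    (h : {poly F} -> {poly F}) : uniq s -> injective h ->
  (forall f, f \in s -> exists2 g, g \in A & val g = h f) ->
  (size s <= #|A|)%N.
Proof.
move=> us hinj hs; rewrite cardE.
rewrite -(size_map (fun g : {poly_m F} => val g)) -(size_map h s).
apply: uniq_leq_size => [|_ /mapP[f /hs[g gA gE] ->]].
  by rewrite map_inj_uniq.
by rewrite -gE map_f// mem_enum.
Qed.

Lemma exists_monic_gcd f g : f != 0 ->
  exists d, [/\ d \is monic, d %| f, d %| g & d %= gcdp f g].
Proof.
move=> f0; have gcd0 : gcdp f g != 0 by rewrite gcdp_eq0 (negPf f0).
have lc0 : (lead_coef (gcdp f g))^-1 != 0 by rewrite invr_eq0 lead_coef_eq0.
exists ((lead_coef (gcdp f g))^-1 *: gcdp f g).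
rewrite !dvdpZl// dvdp_gcdl dvdp_gcdr eqp_scale//; split=> //.
by rewrite monicE lead_coefZ mulVf ?lead_coef_eq0.
Qed.

Lemma gcd_neq1 f g d : ~~ coprimep f g -> d %= gcdp f g -> d != 1.
Proof.
rewrite coprimep_def => /negP nc dg; apply/eqP => d1; apply: nc.
by rewrite -(eqp_size dg) d1 size_poly1.
Qed.

Definition monic_of_tuple c n (u : n.-tuple F) : {poly F} :=
  Poly (c :: rcons u 1).

Lemma monic_of_tupleE c n (u : n.-tuple F) :
  monic_of_tuple c u = c :: rcons u 1 :> seq F.
Proof. by rewrite (@PolyK _ c)//= last_rcons oner_eq0. Qed.

Lemma monic_of_tuple_inj c n : injective (@monic_of_tuple c n).
Proof.
move=> u v /(congr1 polyseq); rewrite !monic_of_tupleE => -[].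
by move/rcons_inj => [/val_inj].
Qed.

Lemma monic_of_tuple_monic c n (u : n.-tuple F) :
  monic_of_degree n.+1 (monic_of_tuple c u).
Proof.
rewrite /monic_of_degree monicE lead_coefE monic_of_tupleE/= size_rcons size_tuple.
by rewrite /= nth_rcons size_tuple ltnn !eqxx.
Qed.

Lemma monic_of_tuple_coef c n (u : n.-tuple F) i :
  (monic_of_tuple c u)`_i =
  if i == 0%N then c else if (i <= n)%N then u`_i.-1 else (i == n.+1)%:R.
Proof.
rewrite monic_of_tupleE; case: i => //= i; rewrite nth_rcons size_tuple eqSS.
by case: ltnP => // _; case: eqP.
Qed.

Lemma monic_of_tuple_surj c n f : monic_of_degree n.+1 f -> f`_0 = c ->
  exists u : n.-tuple F, f = monic_of_tuple c u.
Proof.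
move=> /andP[/monicP + /eqP sf] f0; rewrite lead_coefE sf /= => lf.
have [s sE] : exists s, f = c :: s :> seq F.
  by case: (polyseq f) sf f0 => // x s _ /= <-; exists s.
case/lastP: s sE => [|s y] sE; first by move: sf; rewrite sE.
have sn : size s = n by move: sf; rewrite sE /= size_rcons => -[].
have us : size s == n by rewrite sn.
move: lf; rewrite sE /= nth_rcons sn ltnn eqxx => y1.
by exists (Tuple us); apply: val_inj; rewrite /= monic_of_tupleE sE y1.
Qed.

Lemma count_monics c n (P : pred {poly F}) : (forall f, P f -> f`_0 = c) ->
  count P (monics n.+1) = #|[set u : n.-tuple F | P (monic_of_tuple c u)]|.
Proof.
move=> Pc; rewrite cardE -(size_map (@monic_of_tuple c n)) -size_filter.
apply/perm_size/uniq_perm.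
- by rewrite filter_uniq// monics_uniq.
- by rewrite map_inj_uniq ?enum_uniq//; apply: monic_of_tuple_inj.
move=> f; rewrite mem_filter monicsE; apply/andP/mapP => [[Pf fn]|[u]].
  have [u fu] := monic_of_tuple_surj fn (Pc f Pf).
  by exists u => //; rewrite mem_enum inE -fu.
by rewrite mem_enum inE => Pu ->; rewrite monic_of_tuple_monic.
Qed.

End Monics.

Section PolySystem.
Variables (F : finFieldType) (w : nat) (M : pred {poly F}).
Variables (chi : {poly F} -> F) (vals : {set F}) (bs rt : nat).
Hypothesis w_gt0 : (0 < w)%N.
Hypothesis M_monic : forall f, M f -> f \is monic.
Hypothesis M1 : M 1.
Hypothesis MM : forall f g, M f -> M g -> M (f * g).
Hypothesis M_div : forall f g, M f -> M (f * g) -> M g.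
Hypothesis M_common : forall f g, M f -> M g -> ~~ coprimep f g ->
  exists d, [/\ M d, d != 1, d %| f & d %| g].
Hypothesis M_size : forall f, M f -> (w %| (size f).-1)%N.
Hypothesis chi_vals : forall f, M f -> chi f \in vals.
Hypothesis chiM : forall f g, M f -> M g -> chi (f * g) = chi f * chi g.
Hypothesis vals_neq0 : forall c, c \in vals -> c != 0.
Hypothesis vals_div : forall b c, b \in vals -> c \in vals -> c / b \in vals.
Hypothesis bs_ge2 : (2 <= bs)%N.
Hypothesis rt_gt0 : (0 < rt)%N.
Hypothesis rt_le_bs : (rt <= bs)%N.
Hypothesis card_count : forall n c, (0 < n)%N -> c \in vals ->
  (rt * count (fun f => M f && (chi f == c)) (monics F (w * n)) = bs ^ n)%N.
Hypothesis card_vals_ge : (rt * bs <= #|vals| * bs + rt)%N.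
Hypothesis card_vals_le : (#|vals| * bs <= rt * bs + rt)%N.

Let degree (f : {poly F}) := ((size f).-1 %/ w)%N.
Let elements n := [seq f <- monics F (w * n) | M f].

Let degreeM f g : M f -> M g -> degree (f * g) = (degree f + degree g)%N.
Proof.
move=> fM gM; rewrite /degree -divnDl ?M_size//; congr (_ %/ _)%N.
have f0 := monic_neq0 (M_monic fM); have g0 := monic_neq0 (M_monic gM).
rewrite size_mul//; move: f0 g0; rewrite -!size_poly_gt0.
by case: (size f) => // a; case: (size g) => // b; rewrite /= addnS.
Qed.

Let degree_eq0 f : M f -> degree f = 0%N -> f = 1.
Proof.
move=> fM d0; have fm := M_monic fM.
have : ((size f).-1 = degree f * w)%N by rewrite divnK// M_size.
rewrite d0 mul0n => s1.
have sf : (size f <= 1)%N by move: s1; case: (size f) => [|[]].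
have := size1_polyC sf; move: fm => /monicP; rewrite lead_coefE s1 => -> ->.
by [].
Qed.

Let elements_uniq n : uniq (elements n).
Proof. by rewrite filter_uniq// monics_uniq. Qed.

Let elementsE n f : (f \in elements n) = M f && (degree f == n).
Proof.
rewrite mem_filter monicsE; have [fM/=|//] := boolP (M f).
rewrite /monic_of_degree (M_monic fM)/=.
have sf : size f = (degree f * w).+1.
  rewrite divnK ?M_size// prednK// size_poly_gt0.
  exact: monic_neq0 (M_monic fM).
by rewrite sf eqSS mulnC eqn_pmul2l.
Qed.

Let elements_count n c : (0 < n)%N -> c \in vals ->
  (rt * count (fun f => chi f == c) (elements n) = bs ^ n)%N.
Proof.
move=> n0 cV; rewrite -(card_count n0 cV) count_filter.
by congr (_ * _)%N; apply: eq_count => f /=; rewrite andbC.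
Qed.

Definition poly_system : factor_system F :=
  FactorSystem M_monic M1 MM M_div M_common degreeM degree_eq0 elements_uniq
    elementsE chi_vals chiM vals_neq0 vals_div bs_ge2 rt_gt0 rt_le_bs
    elements_count card_vals_ge card_vals_le.

End PolySystem.

(** * Reversal and duality *)

Section Reversal.
Variable F : fieldType.
Implicit Types (f g : {poly F}) (n m : nat).

Definition reversal n f : {poly F} := \poly_(i < n.+1) f`_(n - i).

Local Notation frac := (@tofrac {poly F}).
Local Notation X := (frac 'X).
Local Notation iota_frac := (frac \o @polyC F).

(** Read in the fraction field, the reversal is X^n f(1/X), which makes it
    multiplicative. *)
Lemma reversal_frac n f : (size f <= n.+1)%N ->
  frac (reversal n f) = X ^+ n * (map_poly iota_frac f).[X^-1].
Proof.
move=> fn; have X0 : X != 0 by rewrite tofrac_eq0 polyX_eq0.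
rewrite (horner_coef_wide (n := n.+1)) ?size_map_poly//.
rewrite /reversal poly_def rmorph_sum/= (reindex_inj rev_ord_inj)/= mulr_sumr.
apply: eq_bigr => i _; rewrite coef_map/= subSS.
have iN : (i <= n)%N by rewrite -ltnS.
rewrite subKn// -mul_polyC tofracM mulrCA; congr (_ * _).
by rewrite exprVn tofracXn -expfB_cond ?(negPf X0).
Qed.

Lemma reversalM n m f g : (size f <= n.+1)%N -> (size g <= m.+1)%N ->
  reversal (n + m) (f * g) = reversal n f * reversal m g.
Proof.
move=> fn gm; apply/eqP; rewrite -tofrac_eq tofracM.
rewrite !reversal_frac//; last first.
  apply: leq_trans (size_polyMleq _ _) _.
  by case: (size f) fn => [|a]; case: (size g) gm => [|b] /=; lia.
by rewrite rmorphM hornerM exprD mulrACA.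
Qed.

Lemma coef_reversal n f i :
  (reversal n f)`_i = if (i <= n)%N then f`_(n - i) else 0.
Proof. by rewrite coef_poly ltnS. Qed.

End Reversal.

(** The hypothesis is an argument so that the structure of ring morphism can
    be attached to the function. *)
Definition frob (F : finFieldType) r (h : [pchar F].-nat r) (x : F) := x ^+ r.

Section Frob.
Variables (F : finFieldType) (r : nat) (h : [pchar F].-nat r).

Lemma frob_is_zmod_morphism : zmod_morphism (frob h).
Proof. by move=> x y; rewrite /frob exprDn_pchar// exprNn_pchar. Qed.

Lemma frob_is_monoid_morphism : monoid_morphism (frob h).
Proof. by split=> [|x y]; rewrite /frob ?expr1n ?exprMn. Qed.

HB.instance Definition _ :=
  GRing.isZmodMorphism.Build F F (frob h) frob_is_zmod_morphism.
HB.instance Definition _ :=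
  GRing.isMonoidMorphism.Build F F (frob h) frob_is_monoid_morphism.

End Frob.

Section Dagger.
Variables (F : finFieldType) (r : nat).
Hypothesis r_pchar : [pchar F].-nat r.
Implicit Types (f g d : {poly F}) (n m i : nat).
Local Notation bar := (map_poly (frob r_pchar)).

Lemma coef_bar f i : (bar f)`_i = f`_i ^+ r.
Proof. by rewrite coef_map. Qed.

Lemma size_bar f : size (bar f) = size f.
Proof. by rewrite size_map_poly. Qed.

(** For r = 1 the conjugation is trivial, so star-symmetric polynomials are
    covered as well. *)
Definition dual_monic f := (f \is monic) && dagger_symmetric r f.

Lemma dual_monic_monic f : dual_monic f -> f \is monic.
Proof. by case/andP. Qed.

Lemma daggerE f : f != 0 ->
  dagger r f = (f`_0 ^+ r)^-1 *: reversal (size f).-1 (bar f).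
Proof.
move=> f0; have -> : dagger r f = (bar f).[0]^-1 *: reversed (bar f) by [].
rewrite horner_coef0 coef_bar; congr (_ *: _).
by rewrite /reversed size_bar /reversal prednK// size_poly_gt0.
Qed.

Lemma coef_reversal_bar_size f : (reversal (size f).-1 (bar f))`_0 =
  lead_coef f ^+ r.
Proof. by rewrite coef_reversal subn0 coef_bar lead_coefE. Qed.

Lemma dual_monicE f : f \is monic ->
  dual_monic f = (f == f`_0 *: reversal (size f).-1 (bar f)).
Proof.
move=> fm; have f0 := monic_neq0 fm; rewrite /dual_monic fm /dagger_symmetric /=.
rewrite daggerE// horner_coef0; apply/idP/eqP => [/andP[c0 /eqP dE]|fE].
  have := congr1 (fun g : {poly F} => g`_0) dE => /=.
  rewrite coefZ coef_reversal_bar_size (monicP fm) expr1n mulr1 => c0E.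
  by rewrite -{1}dE c0E.
have : f`_0 * f`_0 ^+ r = 1.
  have := monicP fm; rewrite lead_coefE {1}fE coefZ coef_reversal leqnn subnn.
  by rewrite coef_bar.
move=> c0E; have c0 : f`_0 != 0.
  by apply: contra_eq_neq c0E => ->; rewrite mul0r eq_sym oner_eq0.
rewrite c0 /=; apply/eqP; rewrite [RHS]fE; congr (_ *: _).
by apply: (mulIf (expf_neq0 r c0)); rewrite mulVf ?expf_neq0.
Qed.

Lemma dual_monic_const f : dual_monic f -> f`_0 ^+ r.+1 = 1.
Proof.
move=> fd; have fm := dual_monic_monic fd.
move: fd; rewrite dual_monicE// => /eqP fE.
have := monicP fm; rewrite lead_coefE {1}fE coefZ coef_reversal leqnn subnn.
by rewrite coef_bar exprS.
Qed.

Lemma dual_monic_const_neq0 f : dual_monic f -> f`_0 != 0.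
Proof.
move=> /dual_monic_const c1; apply: contra_eq_neq c1 => ->.
by rewrite expr0n eq_sym oner_eq0.
Qed.

Lemma dual_monicP n f : monic_of_degree n f ->
  reflect (forall i, (i <= n)%N -> f`_i = f`_0 * f`_(n - i) ^+ r) (dual_monic f).
Proof.
move=> /andP[fm /eqP sf]; rewrite dual_monicE// sf /=.
apply: (iffP eqP) => [fE i i_n|fE].
  by rewrite {1}fE coefZ coef_reversal i_n coef_bar.
apply/polyP => i; rewrite coefZ coef_reversal coef_bar.
case: leqP => // [/fE //|ni].
by rewrite mulr0 nth_default// sf.
Qed.

Lemma dual_monic1 : dual_monic 1.
Proof.
apply/(dual_monicP (n := 0)); first by rewrite /monic_of_degree monic1 size_poly1.
by move=> [|i]// _; rewrite coef1 expr1n mul1r.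
Qed.

Lemma size_monicM_pred f g : f \is monic -> g \is monic ->
  (size (f * g)).-1 = ((size f).-1 + (size g).-1)%N.
Proof.
move=> /monic_neq0 f0 /monic_neq0 g0; rewrite size_mul//.
move: f0 g0; rewrite -!size_poly_gt0.
by case: (size f) => // a; case: (size g) => // b; rewrite /= addnS.
Qed.

Lemma reversal_barM f g : f \is monic -> g \is monic ->
  reversal (size (f * g)).-1 (bar (f * g)) =
  reversal (size f).-1 (bar f) * reversal (size g).-1 (bar g).
Proof.
move=> fm gm; rewrite size_monicM_pred// rmorphM reversalM// size_bar.
  by rewrite prednK// size_poly_gt0 monic_neq0.
by rewrite prednK// size_poly_gt0 monic_neq0.
Qed.

Lemma dual_monicM f g : dual_monic f -> dual_monic g -> dual_monic (f * g).
Proof.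
move=> fd gd; have fm := dual_monic_monic fd; have gm := dual_monic_monic gd.
rewrite dual_monicE ?monicMl// reversal_barM// coef0M.
move: fd gd; rewrite !dual_monicE// => /eqP fE /eqP gE.
by rewrite -scalerA scalerAr scalerAl -fE -gE.
Qed.

Lemma dual_monic_div f g : dual_monic f -> dual_monic (f * g) -> dual_monic g.
Proof.
move=> fd fgd; have fm := dual_monic_monic fd.
have gm : g \is monic by rewrite -(monicMl _ fm) dual_monic_monic.
move: fd fgd; rewrite !dual_monicE ?monicMl// reversal_barM// coef0M.
move=> /eqP fE; rewrite -scalerA scalerAr scalerAl -fE => /eqP.
by move=> /(mulfI (monic_neq0 fm)) {1}->.
Qed.

Lemma reversal_bar_dvd d f : d \is monic -> dual_monic f -> d %| f ->
  reversal (size d).-1 (bar d) %| f.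
Proof.
move=> dm fd /dvdpP[e fE]; rewrite mulrC in fE.
have fm := dual_monic_monic fd.
have em : e \is monic by rewrite -(monicMl _ dm) -fE.
have f0 := dual_monic_const_neq0 fd.
move: fd; rewrite dual_monicE// => /eqP ->; rewrite dvdpZr//.
by rewrite fE reversal_barM// dvdp_mulr.
Qed.

(** The reversed conjugate of the monic gcd d divides both f and g, hence d,
    and has the same degree; so it is a constant multiple of d, which makes d
    dual. *)
Lemma dual_monic_common f g : dual_monic f -> dual_monic g ->
  exists d, [/\ dual_monic d, d %| f, d %| g & d %= gcdp f g].
Proof.
move=> fd gd; have fm := dual_monic_monic fd; have gm := dual_monic_monic gd.
have f0 := dual_monic_const_neq0 fd.
have [d [dm df dg dgcd]] := exists_monic_gcd g (monic_neq0 fm).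
exists d; split=> //.
have dc0 : d`_0 != 0.
  have /dvdpP[e fE] := df; apply: contra f0 => /eqP dc.
  by rewrite fE coef0M dc mulr0.
set n := (size d).-1; have sd : size d = n.+1.
  by rewrite prednK// size_poly_gt0 monic_neq0.
pose e := reversal n (bar d).
have ec : e`_n = d`_0 ^+ r by rewrite coef_reversal leqnn subnn coef_bar.
have ed : e %| d.
  by rewrite (eqp_dvdr _ dgcd) dvdp_gcd !reversal_bar_dvd.
have se : size e = size d.
  apply/eqP; rewrite eqn_leq sd size_poly/= ltnNge; apply/negP => /leq_sizeP.
  move=> /(_ n (leqnn _)); rewrite ec => /eqP.
  by rewrite expf_eq0 (negPf dc0) andbF.
have : e %= d by rewrite -dvdp_size_eqp// se.
move=> /eqp_eq; rewrite (monicP dm) scale1r lead_coefE se sd ec => eE.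
rewrite dual_monicE// -/n -/e eE scalerA.
have : e`_0 = 1.
  by rewrite coef_reversal_bar_size (monicP dm) expr1n.
by rewrite eE coefZ mulrC => ->; rewrite scale1r.
Qed.

End Dagger.

Section TwistedPalindromes.
Variables (F : finFieldType) (r : nat).
Hypothesis r_pchar : [pchar F].-nat r.
Hypothesis cardF : #|F| = (r ^ 2)%N.

Lemma frobK (x : F) : (x ^+ r) ^+ r = x.
Proof. by rewrite -exprM -[(r * r)%N]/(r ^ 2)%N -cardF expf_card. Qed.

Lemma r_gt1 : (1 < r)%N.
Proof.
have := finNzRing_gt1 F; rewrite cardF.
by case: r => [|[]].
Qed.

Lemma exists_not_frob_fixed : exists w : F, w ^+ r != w.
Proof.
apply/existsP; apply: contraT; rewrite negb_exists => /forallP fixed.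
have r1 := r_gt1.
have := @max_poly_roots F ('X^r - 'X) (enum F).
have sz : size ('X^r - 'X : {poly F}) = r.+1.
  by rewrite size_polyDl size_polyXn// size_polyN size_polyX.
rewrite -size_poly_eq0 sz -cardE enum_uniq cardF => /(_ isT _ isT).
have -> : all (root ('X^r - 'X)) (enum F).
  apply/allP => x _; rewrite rootE !hornerE_comm hornerXn subr_eq0.
  by have := fixed x; rewrite negbK.
by move=> /(_ isT); rewrite ltnS -{2}(expn1 r) leq_exp2l.
Qed.

Definition twisted_palindromes (a : F) n : {set n.-tuple F} :=
  [set u | [forall i : 'I_n, tnth u i == a * tnth u (rev_ord i) ^+ r]].

(** These are the tuples fixed by a semilinear involution. If w^r != w, every
    tuple can be written uniquely as u + w v with fixed u and v, so that the
    number of fixed tuples is the square root of the number of all tuples. The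
    argument is the same for both parities of n and in all characteristics. *)
Lemma card_twisted_palindromes a n : a ^+ r.+1 = 1 ->
  #|twisted_palindromes a n| = (r ^ n)%N.
Proof.
move=> a1; set A := twisted_palindromes a n.
have AP u : reflect (forall i, tnth u i = a * tnth u (rev_ord i) ^+ r) (u \in A).
  by rewrite inE; apply: (iffP forallP) => h i; apply/eqP/h.
have [w wr] := exists_not_frob_fixed.
have wr0 : w - w ^+ r != 0 by rewrite subr_eq0 eq_sym.
pose h (uv : n.-tuple F * n.-tuple F) : n.-tuple F :=
  [tuple tnth uv.1 i + w * tnth uv.2 i | i < n].
have hE uv i : tnth (h uv) i = tnth uv.1 i + w * tnth uv.2 i.
  by rewrite tnth_mktuple.
have frobB (x y : F) : (x - y) ^+ r = x ^+ r - y ^+ r.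
  by rewrite exprDn_pchar// exprNn_pchar.
have frobD (x y : F) : (x + y) ^+ r = x ^+ r + y ^+ r by rewrite exprDn_pchar.
have tauh uv i : uv \in setX A A ->
   a * tnth (h uv) (rev_ord i) ^+ r = tnth uv.1 i + w ^+ r * tnth uv.2 i.
  rewrite inE => /andP[/AP u1 /AP v1].
  by rewrite hE frobD exprMn mulrDr -u1 mulrCA -v1.
suff cardAA : #|setX A A| = #|{: n.-tuple F}|.
  apply/eqP; rewrite -(eqn_exp2r _ _ (isT : (0 < 2)%N)) -expnM mulnC expnM.
  by rewrite -cardF -card_tuple -cardAA cardsX mulnn.
rewrite -(card_in_imset (f := h)) => [|uv uv' uvA uv'A huv].
  rewrite -cardsT; apply: eq_card => t; rewrite in_setT; apply/imsetP.
  (* solves t = u + w v together with its image tau t = u + w^r v *)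
  pose v : n.-tuple F :=
    [tuple (tnth t i - a * tnth t (rev_ord i) ^+ r) / (w - w ^+ r) | i < n].
  pose u : n.-tuple F := [tuple tnth t i - w * tnth v i | i < n].
  have vE i : tnth v i = (tnth t i - a * tnth t (rev_ord i) ^+ r) / (w - w ^+ r).
    by rewrite tnth_mktuple.
  have uE i : tnth u i = tnth t i - w * tnth v i by rewrite tnth_mktuple.
  have vA i : tnth v i = a * tnth v (rev_ord i) ^+ r.
    have vr : tnth v (rev_ord i) ^+ r =
        (tnth t (rev_ord i) ^+ r - a ^+ r * tnth t i) / (w ^+ r - w).
      by rewrite vE rev_ordK exprMn exprVn !frobB exprMn !frobK.
    rewrite vr vE -(opprB w) invrN !mulrN mulrA -mulNr; congr (_ / _).
    by rewrite mulrBr mulrA -exprS a1 mul1r opprB.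
  exists (u, v); last by apply: eq_from_tnth => i; rewrite hE uE subrK.
  rewrite inE/=; apply/andP; split; apply/AP => // i.
  rewrite !uE frobB exprMn mulrBr mulrCA -vA.
  have -> : tnth t i = a * tnth t (rev_ord i) ^+ r + (w - w ^+ r) * tnth v i.
    by rewrite vE [X in _ + X]mulrC divfK// addrC subrK.
  by ring.
have eqt i : tnth uv.1 i + w * tnth uv.2 i = tnth uv'.1 i + w * tnth uv'.2 i.
  by rewrite -!hE huv.
have eqtau i : tnth uv.1 i + w ^+ r * tnth uv.2 i =
               tnth uv'.1 i + w ^+ r * tnth uv'.2 i.
  by rewrite -!tauh ?huv.
have eq2 i : tnth uv.2 i = tnth uv'.2 i.
  apply: (mulfI wr0); rewrite !mulrBl.
  have := congr2 (fun x y => x - y) (eqt i) (eqtau i).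
  have sub (x y z : F) : (x + y) - (x + z) = y - z by ring.
  by rewrite /= !sub.
case: uv uv' eqt eq2 {eqtau uvA uv'A huv} => u v [u' v'] /= eqt eq2.
have vv : v = v' by apply: eq_from_tnth.
congr (_, _) => //; apply: eq_from_tnth => i.
by have := eqt i; rewrite vv => /addIr.
Qed.

End TwistedPalindromes.

(** * The system of polynomials with nonzero constant coefficient *)

Section NonzeroConstant.
Variable F : finFieldType.
Implicit Types f g : {poly F}.

Let M := [pred f : {poly F} | (f \is monic) && (f`_0 != 0)].
Let vals : {set F} := [set x | x != 0].
Let q := #|F|.

Let M_monic f : M f -> f \is monic. Proof. by case/andP. Qed.

Let M1 : M 1. Proof. by rewrite /= monic1 coef1 oner_eq0. Qed.

Let MM f g : M f -> M g -> M (f * g).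
Proof.
by move=> /andP[fm f0] /andP[gm g0]; rewrite /= monicMl// gm coef0M mulf_neq0.
Qed.

Let M_div f g : M f -> M (f * g) -> M g.
Proof.
move=> /andP[fm f0]; rewrite /= monicMl// coef0M mulf_eq0 negb_or.
by move=> /and3P[-> _ ->].
Qed.

Let M_dvd d f : d \is monic -> M f -> d %| f -> M d.
Proof.
move=> dm /andP[fm f0] /dvdpP[e fE]; rewrite /= dm.
by move: f0; rewrite fE coef0M mulf_eq0 negb_or => /andP[].
Qed.

Let M_common f g : M f -> M g -> ~~ coprimep f g ->
  exists d, [/\ M d, d != 1, d %| f & d %| g].
Proof.
move=> fM gM nc; have fm := M_monic fM.
have [d [dm df dg dgcd]] := exists_monic_gcd g (monic_neq0 fm).
by exists d; split=> //; [apply: M_dvd df|apply: gcd_neq1 nc dgcd].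
Qed.

Let card_count n c : (0 < n)%N -> c \in vals ->
  (q * count (fun f => M f && (f`_0 == c)%R) (monics F (1 * n)) = q ^ n)%N.
Proof.
case: n => // n _; rewrite inE => c0; rewrite mul1n.
rewrite (@count_monics _ c n) => [|f /andP[_ /eqP]//].
rewrite expnS -card_tuple -cardsT; congr (_ * _)%N; apply: eq_card => u.
rewrite !inE /= monic_of_tuple_coef/= c0 eqxx !andbT.
by have /andP[] := monic_of_tuple_monic c u.
Qed.

Let card_vals : #|vals| = q.-1.
Proof.
by rewrite -(cardC1 (0 : F)); apply: eq_card => x; rewrite !inE.
Qed.

Let q_gt1 : (1 < q)%N. Proof. exact: finNzRing_gt1. Qed.

Let chi_vals f : M f -> f`_0 \in vals.
Proof. by move=> /andP[_ f0]; rewrite inE. Qed.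

Let chiM f g : M f -> M g -> (f * g)`_0 = f`_0 * g`_0.
Proof. by move=> _ _; rewrite coef0M. Qed.

Let vals_neq0 c : c \in vals -> c != 0. Proof. by rewrite inE. Qed.

Let vals_div b c : b \in vals -> c \in vals -> c / b \in vals.
Proof. by rewrite !inE => b0 c0; rewrite mulf_neq0// invr_eq0. Qed.

Let card_vals_ge : (q * q <= #|vals| * q + q)%N.
Proof. by rewrite card_vals -mulSnr prednK// ltnW. Qed.

Let card_vals_le : (#|vals| * q <= q * q + q)%N.
Proof.
by rewrite card_vals (leq_trans _ (leq_addr _ _))// leq_mul2r leq_pred orbT.
Qed.

Definition nonzero_constant_system : factor_system F :=
  poly_system (w := 1) isT M_monic M1 MM M_div M_common (fun f _ => dvd1n _)
    chi_vals chiM vals_neq0 vals_div q_gt1 (ltnW q_gt1) (leqnn q) card_count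
    card_vals_ge card_vals_le.

Lemma H_le_count_multiples (a : F) n k : a != 0 ->
  (H a n k <= count_multiples nonzero_constant_system a n k)%N.
Proof.
move=> a0; rewrite /count_multiples -size_filter.
apply: (card_npoly_le (h := id)) => [f g _ _ /val_inj//|f].
rewrite !inE => /andP[/andP[/andP[fm sf]]].
rewrite horner_coef0 => fa /existsP[g /andP[/andP[gm sg] gf]].
have fM : M (val f) by rewrite /= fm (eqP fa).
have in_elems h i : M h -> monic_of_degree i h ->
    h \in elems nonzero_constant_system i.
  by move=> hM hi; rewrite mem_filter hM monicsE mul1n.
rewrite mem_filter in_elems ?/monic_of_degree ?fm ?sf// andbT.
apply/andP; split=> //; apply/hasP; exists (val g) => //.
by rewrite in_elems ?(M_dvd gm fM gf)// /monic_of_degree gm sg.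
Qed.

End NonzeroConstant.

(** * The system of dual polynomials *)

Section DualMonic.
Variables (F : finFieldType) (r : nat).
Hypothesis r_pchar : [pchar F].-nat r.
Hypothesis cardF : #|F| = (r ^ 2)%N.
Implicit Types f g : {poly F}.

Let M := [pred f : {poly F} | dual_monic r f].
Let vals : {set F} := [set x | x ^+ r.+1 == 1].
Hypothesis card_vals : #|vals| = r.+1.

Let r_gt1 : (1 < r)%N. Proof. exact: r_gt1 cardF. Qed.

Let M_monic f : M f -> f \is monic. Proof. exact: dual_monic_monic. Qed.

Let M1 : M 1. Proof. exact: dual_monic1 r_pchar. Qed.

Let MM f g : M f -> M g -> M (f * g). Proof. exact: dual_monicM r_pchar _ _. Qed.

Let M_div f g : M f -> M (f * g) -> M g.
Proof. exact: dual_monic_div r_pchar _ _. Qed.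

Let M_common f g : M f -> M g -> ~~ coprimep f g ->
  exists d, [/\ M d, d != 1, d %| f & d %| g].
Proof.
move=> fM gM nc; have [d [dM df dg dgcd]] := dual_monic_common r_pchar fM gM.
by exists d; split=> //; apply: gcd_neq1 nc dgcd.
Qed.

Let card_count n c : (0 < n)%N -> c \in vals ->
  (r * count (fun f => M f && (f`_0 == c)%R) (monics F (1 * n)) = r ^ n)%N.
Proof.
case: n => // n _; rewrite inE => /eqP c1; rewrite mul1n.
rewrite (@count_monics _ c n) => [|f /andP[_ /eqP]//].
rewrite expnS -(card_twisted_palindromes r_pchar cardF n c1).
congr (_ * _)%N; apply: eq_card => u.
rewrite !inE /= monic_of_tuple_coef/= eqxx andbT.
have uP i : tnth u i = u`_i by rewrite (tnth_nth 0).
have revP (i : 'I_n) : (rev_ord i : nat) = (n - i.+1)%N by [].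
have := monic_of_tuple_monic c u => /(dual_monicP r_pchar) coefs.
apply/coefs/forallP => [fE i|uE [|i] i_n].
- have := fE i.+1 (leqW (ltn_ord i)).
  rewrite !monic_of_tuple_coef/= ltn_ord subSS subn_eq0 leqNgt ltn_ord/=.
  rewrite leq_subr !uP revP subnS => ->; exact: eqxx.
- rewrite subn0 !monic_of_tuple_coef/= ltnn eqxx expr1n mulr1//.
- rewrite !monic_of_tuple_coef/= subSS; move: i_n; rewrite ltnS leq_eqVlt.
  case/predU1P => [->|i_n].
    by rewrite ltnn eqxx subnn/= -exprS c1.
  rewrite i_n subn_eq0 leqNgt i_n/= leq_subr.
  by have /eqP := uE (Ordinal i_n); rewrite !uP revP subnS.
Qed.

Let chi_vals f : M f -> f`_0 \in vals.
Proof. by move=> fM; rewrite inE (dual_monic_const r_pchar fM). Qed.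

Let chiM f g : M f -> M g -> (f * g)`_0 = f`_0 * g`_0.
Proof. by move=> _ _; rewrite coef0M. Qed.

Let vals_neq0 c : c \in vals -> c != 0.
Proof.
rewrite inE => /eqP c1; apply: contra_eq_neq c1 => ->.
by rewrite expr0n eq_sym oner_eq0.
Qed.

Let vals_div b c : b \in vals -> c \in vals -> c / b \in vals.
Proof. by rewrite !inE expr_div_n => /eqP-> /eqP->; rewrite divr1. Qed.

Let card_vals_ge : (r * r <= #|vals| * r + r)%N.
Proof. by rewrite card_vals mulSn; lia. Qed.

Let card_vals_le : (#|vals| * r <= r * r + r)%N.
Proof. by rewrite card_vals mulSn addnC. Qed.

Definition dual_monic_system : factor_system F :=
  poly_system (w := 1) isT M_monic M1 MM M_div M_common (fun f _ => dvd1n _)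
    chi_vals chiM vals_neq0 vals_div r_gt1 (ltnW r_gt1) (leqnn r) card_count
    card_vals_ge card_vals_le.

Lemma HDagger_le_count_multiples (a : F) n k :
  (HDagger r a n k <= count_multiples dual_monic_system a n k)%N.
Proof.
rewrite /count_multiples -size_filter.
apply: (card_npoly_le (h := id)) => [f g _ _ /val_inj//|f].
rewrite !inE => /andP[/andP[/andP[fmn fa] fd]].
rewrite horner_coef0 in fa.
move=> /existsP[g /and3P[gmn gd gf]].
have in_elems h i : monic_of_degree i h -> dagger_symmetric r h ->
    h \in elems dual_monic_system i.
  move=> hi hd; rewrite mem_filter monicsE mul1n hi andbT /= /dual_monic hd.
  by case/andP: hi => ->.
rewrite mem_filter in_elems// andbT.
by apply/andP; split=> //; apply/hasP; exists (val g) => //; rewrite in_elems.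
Qed.

End DualMonic.

(** * Star-symmetric polynomials of even degree *)

Lemma sum_antisymmetric (V : zmodType) (t : nat -> V) h :
  (forall i, (i < h.*2)%N -> t i + t (h.*2.-1 - i)%N = 0) ->
  \sum_(0 <= i < h.*2) t i = 0.
Proof.
elim: h t => [|h IH] t anti; first by rewrite big_geq.
rewrite doubleS big_nat_recl// big_nat_recr//= addrCA.
rewrite (IH (fun i => t i.+1)) ?add0r => [|i ih].
  by have := anti 0%N isT; rewrite subn0 doubleS/=.
have := anti i.+1; rewrite doubleS /= !ltnS (ltnW ih) => /(_ isT).
have -> // : (h.*2.+1 - i.+1 = (h.*2.-1 - i).+1)%N.
by case: h ih {IH anti} => // h ih; rewrite doubleS/= -subSn.
Qed.

Section Star.
Variable F : finFieldType.
Implicit Types (f g d : {poly F}) (a b : F) (n k : nat).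

Lemma one_pchar : [pchar F].-nat 1. Proof. by []. Qed.

Local Notation star_monic := (dual_monic (F := F) 1).

Lemma star_symmetricE f : star_symmetric f = dagger_symmetric 1 f.
Proof.
rewrite /star_symmetric /dagger_symmetric /star /dagger.
have -> // : bar 1 f = f.
by apply/polyP => i; rewrite coef_map_id0 ?expr1.
Qed.

Lemma star_monic_coef f i : star_monic f -> (i <= (size f).-1)%N ->
  f`_i = f`_0 * f`_((size f).-1 - i).
Proof.
move=> fs; have fm := dual_monic_monic fs.
have fn : monic_of_degree (size f).-1 f.
  by rewrite /monic_of_degree fm prednK ?eqxx// size_poly_gt0 monic_neq0.
by move/(dual_monicP one_pchar fn): fs => fE /fE; rewrite expr1.
Qed.

Lemma star_monic_sqr f : star_monic f -> f`_0 ^+ 2 = 1.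
Proof. by move=> /(dual_monic_const one_pchar). Qed.

(** The terms of index i and n - i in f(-f(0)) cancel. Pairing them also works
    in characteristic 2, where f(x) = -f(x) would say nothing. *)
Lemma star_monic_root_odd f : star_monic f -> odd (size f).-1 ->
  root f (- f`_0).
Proof.
move=> fs; set n := (size f).-1 => n_odd; set a := f`_0.
have a2 : a * a = 1 by rewrite -expr2 star_monic_sqr.
have f_neq0 : f != 0 by apply/monic_neq0/dual_monic_monic/fs.
have sf : size f = (n.+1)./2.*2.
  have -> : size f = n.+1 by rewrite /n prednK// size_poly_gt0.
  by rewrite -[LHS]odd_double_half /= n_odd.
have aX i : (- a) ^+ i = if odd i then - a else 1.
  rewrite -[i in LHS]odd_double_half exprD -mul2n exprM sqrrN expr2 a2 expr1n.
  by case: (odd i); rewrite ?expr1 ?mulr1.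
rewrite rootE horner_coef; apply/eqP.
rewrite -(big_mkord xpredT (fun i => f`_i * (- a) ^+ i)) sf.
apply: sum_antisymmetric => i i_n.
have n_E : ((n.+1)./2.*2.-1 = n)%N by rewrite -sf.
have i_le : (i <= n)%N by rewrite -n_E -ltnS prednK// (leq_trans _ i_n).
rewrite n_E (star_monic_coef fs i_le) -/n -/a !aX oddB// n_odd/=.
case: (odd i) => /=; first by rewrite mulrN mulrAC a2 mul1r mulr1 addNr.
by rewrite mulr1 mulrN [_ * a]mulrC subrr.
Qed.

Lemma star_monic_root_even f x : star_monic f -> ~~ odd (size f).-1 ->
  f`_0 = -1 -> (-1 : F) != 1 -> x ^+ 2 = 1 -> root f x.
Proof.
move=> fs; set n := (size f).-1 => n_even f0 char2 x2.
have f_neq0 : f != 0 by apply/monic_neq0/dual_monic_monic/fs.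
have sf : size f = n.+1 by rewrite /n prednK// size_poly_gt0.
have xX i : x ^+ i = if odd i then x else 1.
  rewrite -[i in LHS]odd_double_half exprD -mul2n exprM x2 expr1n.
  by case: (odd i); rewrite ?expr1 ?mulr1.
have two : (1 + 1 : F) != 0.
  by apply: contra char2; rewrite addr_eq0 eq_sym.
have fx : f.[x] = \sum_(0 <= i < n.+1) f`_i * x ^+ i.
  by rewrite horner_coef big_mkord sf.
have fxN : f.[x] = - f.[x].
  rewrite fx [LHS]big_nat_rev add0n -sumrN; apply: eq_big_nat => i /andP[_ i_n].
  rewrite subSS (star_monic_coef fs) ?leq_subr// -/n subKn// f0 !xX oddB//.
  by rewrite (negPf n_even) mulN1r mulNr.
rewrite rootE; apply/eqP/(mulfI two); rewrite mulr0 mulrDl mul1r {1}fxN.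
by rewrite addNr.
Qed.

Definition linear_factor a : {poly F} := 'X - (- a)%:P.

Lemma linear_factor_monic a : linear_factor a \is monic.
Proof. exact: monicXsubC. Qed.

Lemma linear_factor_coef0 a : (linear_factor a)`_0 = a.
Proof. by rewrite coefB coefX coefC/= sub0r opprK. Qed.

Lemma linear_factor_star a : a ^+ 2 = 1 -> star_monic (linear_factor a).
Proof.
move=> a2; apply/(dual_monicP one_pchar (n := 1)).
  by rewrite /monic_of_degree monicXsubC size_XsubC.
have c1 : (linear_factor a)`_1 = 1 by rewrite coefB coefX coefC/= subr0.
case=> [|[|i]]// _; rewrite expr1 ?subn0 ?subnn c1 linear_factor_coef0 ?mulr1//.
Qed.

(** A factor shared by all star-symmetric polynomials with a given parity o of
    the degree and constant coefficient a; the quotient has even degree and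
    constant coefficient 1. *)
Definition odd_part (odd_deg : bool) a : {poly F} :=
  if odd_deg then linear_factor a
  else if a == 1 then 1 else linear_factor 1 * linear_factor (-1).

Lemma sqr_eq1P a : a ^+ 2 = 1 -> a = 1 \/ a = -1.
Proof. by move/eqP; rewrite sqrf_eq1 => /orP[]/eqP->; [left|right]. Qed.

Lemma sqrN1 : (-1 : F) ^+ 2 = 1. Proof. by rewrite sqrrN expr1n. Qed.

Lemma odd_part_star o a : a ^+ 2 = 1 -> star_monic (odd_part o a).
Proof.
move=> a2; rewrite /odd_part; case: o; first exact: linear_factor_star.
case: eqP => _; first exact: dual_monic1 one_pchar.
by apply: (dual_monicM one_pchar); apply: linear_factor_star;
   rewrite ?sqrN1 ?expr1n.
Qed.

Lemma odd_part_coef0 o a : a ^+ 2 = 1 -> (odd_part o a)`_0 = a.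
Proof.
move=> /sqr_eq1P a1; rewrite /odd_part; case: o; first exact: linear_factor_coef0.
case: eqP a1 => [->|a1 [//|->]]; first by rewrite coef1.
by rewrite coef0M !linear_factor_coef0 mul1r.
Qed.

Definition odd_part_deg (o : bool) a : nat :=
  if o then 1 else if a == 1 then 0 else 2.

Lemma size_odd_part o a : size (odd_part o a) = (odd_part_deg o a).+1.
Proof.
rewrite /odd_part /odd_part_deg; case: o; first by rewrite size_XsubC.
case: eqP => _; first by rewrite size_poly1.
by rewrite size_mul ?polyXsubC_eq0// !size_XsubC.
Qed.

Lemma odd_odd_part_deg o a : odd (odd_part_deg o a) = o.
Proof. by rewrite /odd_part_deg; case: o => //; case: ifP. Qed.

(** Up to the substitution X^n g(X + 1/X) these are all monic polynomials g,
    so they form a factor system for the half degree. *)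
Definition even_star f := [&& star_monic f, ~~ odd (size f).-1 & f`_0 == 1].

Lemma odd_part_dvd f : star_monic f -> odd_part (odd (size f).-1) f`_0 %| f.
Proof.
move=> fs; rewrite /odd_part; have [n_odd|n_even] := boolP (odd (size f).-1).
  by rewrite dvdp_XsubCl star_monic_root_odd.
have [_|a1] := eqVneq f`_0 1; first exact: dvd1p.
have [/eqP|aN1] := sqr_eq1P (star_monic_sqr fs); first by rewrite (negPf a1).
have char2 : (-1 : F) != 1 by rewrite -aN1.
rewrite Gauss_dvdp; last first.
  by rewrite coprimep_XsubC2// !opprK addr_eq0 eq_sym.
by rewrite !dvdp_XsubCl !star_monic_root_even ?sqrrN ?sqrN1 ?expr1n.
Qed.

Lemma star_monic_decomposition f : star_monic f ->
  exists2 g, even_star g & f = odd_part (odd (size f).-1) f`_0 * g.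
Proof.
move=> fs; have a2 := star_monic_sqr fs.
have /dvdpP[g fE] := odd_part_dvd fs; rewrite mulrC in fE.
set l := odd_part _ _ in fE; have ls : star_monic l by apply: odd_part_star.
have l0 : l`_0 = f`_0 by apply: odd_part_coef0.
exists g => //.
have gs : star_monic g by apply: (dual_monic_div one_pchar ls); rewrite -fE.
have a0 : f`_0 != 0 by apply: dual_monic_const_neq0 one_pchar _ fs.
rewrite /even_star gs/=; apply/andP; split.
  have := size_monicM_pred (dual_monic_monic ls) (dual_monic_monic gs).
  rewrite -fE size_odd_part/= => /(congr1 odd).
  rewrite oddD odd_odd_part_deg => /esym/eqP.
  by rewrite -[X in _ == X]addbF; case: (odd _); case: (odd _).
have /eqP := congr1 (fun h : {poly F} => h`_0) fE.
by rewrite /= coef0M l0 -{1}[f`_0]mulr1 => /eqP/(mulfI a0)/esym/eqP.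
Qed.

Lemma even_star_star f : even_star f -> star_monic f. Proof. by case/and3P. Qed.

Lemma even_star_monic f : even_star f -> f \is monic.
Proof. by move=> /even_star_star/dual_monic_monic. Qed.

Lemma even_star1 : even_star 1.
Proof. by rewrite /even_star dual_monic1 ?one_pchar// size_poly1 coef1/=. Qed.

Lemma even_starM f g : even_star f -> even_star g -> even_star (f * g).
Proof.
move=> /and3P[fs fo /eqP f0] /and3P[gs go /eqP g0].
rewrite /even_star (dual_monicM one_pchar)//= coef0M f0 g0 mulr1 eqxx andbT.
rewrite (size_monicM_pred (dual_monic_monic fs) (dual_monic_monic gs)).
by rewrite oddD (negPf fo) (negPf go).
Qed.

Lemma even_star_div f g : even_star f -> even_star (f * g) -> even_star g.
Proof.
move=> /and3P[fs fo /eqP f0] /and3P[fgs].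
have gs := dual_monic_div one_pchar fs fgs.
rewrite /even_star gs/= coef0M f0 mul1r => + ->; rewrite andbT.
rewrite (size_monicM_pred (dual_monic_monic fs) (dual_monic_monic gs)).
by rewrite oddD (negPf fo).
Qed.

Lemma linear_factor_sqr_even_star b : b ^+ 2 = 1 ->
  even_star (linear_factor b ^+ 2).
Proof.
move=> b2; have bs := linear_factor_star b2.
rewrite /even_star expr2 (dual_monicM one_pchar)//=.
rewrite (size_monicM_pred (linear_factor_monic b) (linear_factor_monic b)).
rewrite size_XsubC/=.
by rewrite coef0M linear_factor_coef0 -expr2 b2 eqxx.
Qed.

(** The cofactor of X + b has odd degree and constant coefficient b, so -b is
    also a root of it. *)
Lemma linear_factor_sqr_dvd f b : b ^+ 2 = 1 -> even_star f ->
  linear_factor b %| f -> linear_factor b ^+ 2 %| f.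
Proof.
move=> b2 /and3P[fs fo /eqP f0] /dvdpP[g fE]; rewrite mulrC in fE.
have bs := linear_factor_star b2.
have gs : star_monic g by apply: (dual_monic_div one_pchar bs); rewrite -fE.
have g0 : g`_0 = b.
  have := f0; rewrite fE coef0M linear_factor_coef0 => bg.
  by rewrite -[LHS]mul1r -b2 expr2 -mulrA bg mulr1.
have go : odd (size g).-1.
  move: fo; rewrite fE.
  rewrite (size_monicM_pred (linear_factor_monic b) (dual_monic_monic gs)).
  by rewrite size_XsubC/= negbK.
rewrite expr2 fE dvdp_mul2l ?monic_neq0 ?linear_factor_monic//.
by rewrite dvdp_XsubCl -g0 star_monic_root_odd.
Qed.

(** The monic gcd is star-symmetric. If it is not even, its odd part contains
    some X + b with b = 1 or b = -1, and then (X + b)^2 divides both f and g. *)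
Lemma even_star_common f g : even_star f -> even_star g -> ~~ coprimep f g ->
  exists d, [/\ even_star d, d != 1, d %| f & d %| g].
Proof.
move=> fE gE nc.
have [d [ds df dg dgcd]] :=
  dual_monic_common one_pchar (even_star_star fE) (even_star_star gE).
have d1 := gcd_neq1 nc dgcd.
have [dE|dnE] := boolP (even_star d); first by exists d.
suff [b b2 bd] : exists2 b, b ^+ 2 = 1 & linear_factor b %| d.
  exists (linear_factor b ^+ 2); split.
  - exact: linear_factor_sqr_even_star.
  - apply/eqP => /(congr1 (fun h : {poly F} => size h)); rewrite /= expr2.
    by rewrite size_mul ?polyXsubC_eq0// !size_XsubC size_poly1.
  - by rewrite linear_factor_sqr_dvd// (dvdp_trans bd).
  - by rewrite linear_factor_sqr_dvd// (dvdp_trans bd).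
have := odd_part_dvd ds; rewrite /odd_part.
have [od _|ev] := boolP (odd _).
  by exists d`_0; [apply: star_monic_sqr|rewrite dvdp_XsubCl star_monic_root_odd].
have [d0|_] := eqVneq d`_0 1; first by rewrite /even_star ds ev d0 eqxx in dnE.
by move=> ld; exists 1; rewrite ?expr1n// (dvdp_trans (dvdp_mulr _ _) ld).
Qed.

Definition palindrome n (u : n.-tuple F) : {poly F} :=
  \poly_(i < n.*2.+1) nth 0 (1 :: u) (minn i (n.*2 - i)).

Lemma palindrome_coef n (u : n.-tuple F) i : (i <= n.*2)%N ->
  (palindrome u)`_i = nth 0 (1 :: u) (minn i (n.*2 - i)).
Proof. by rewrite -ltnS coef_poly => ->. Qed.

Lemma palindrome_monic n (u : n.-tuple F) : monic_of_degree n.*2 (palindrome u).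
Proof.
have lead : (palindrome u)`_n.*2 = 1 by rewrite palindrome_coef// subnn minn0.
have sz : size (palindrome u) = n.*2.+1.
  rewrite size_poly_eq//= subnn minn0 /= oner_neq0//.
by rewrite /monic_of_degree monicE lead_coefE sz/= lead !eqxx.
Qed.

Lemma palindrome_even_star n (u : n.-tuple F) : even_star (palindrome u).
Proof.
have um := palindrome_monic u.
have u0 : (palindrome u)`_0 = 1 by rewrite palindrome_coef// min0n.
rewrite /even_star u0 eqxx andbT; apply/andP; split.
  apply/(dual_monicP one_pchar um) => i i_n.
  by rewrite u0 mul1r expr1 !palindrome_coef ?leq_subr// subKn// minnC.
by case/andP: um => _ /eqP->; rewrite /= odd_double.
Qed.

Lemma palindrome_inj n : injective (@palindrome n).
Proof.
move=> u v uv; apply: eq_from_tnth => i; rewrite !(tnth_nth 0).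
have i_n : (i.+1 <= n.*2)%N by rewrite (leq_trans (ltn_ord i))// -addnn leq_addr.
have mi : (minn i.+1 (n.*2 - i.+1) = i.+1)%N.
  by apply/minn_idPl; have := ltn_ord i; rewrite -addnn; lia.
have := congr1 (fun f : {poly F} => f`_i.+1) uv.
by rewrite /= !palindrome_coef// mi.
Qed.

Lemma palindrome_surj n f : monic_of_degree n.*2 f -> even_star f ->
  exists u : n.-tuple F, f = palindrome u.
Proof.
move=> fn /and3P[fs _ /eqP f0].
have sf : size f = n.*2.+1 by case/andP: fn => _ /eqP.
exists [tuple f`_i.+1 | i < n]; apply/polyP => i.
have [i_n|n_i] := leqP i n.*2; last first.
  by rewrite !nth_default// ?sf// (leq_trans (size_poly _ _)).
rewrite palindrome_coef//.
have head j : (j <= n)%N -> nth 0 (1 :: [tuple f`_i0.+1 | i0 < n]) j = f`_j.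
  case: j => [|j] jn /=; first by rewrite f0.
  rewrite (nth_map (Ordinal jn)) ?size_enum_ord//.
  by rewrite nth_enum_ord.
have [i_le|i_gt] := leqP i n.
  have -> : (minn i (n.*2 - i) = i)%N by apply/minn_idPl; rewrite -addnn; lia.
  by rewrite head.
have -> : (minn i (n.*2 - i) = n.*2 - i)%N by apply/minn_idPr; rewrite -addnn; lia.
rewrite head; last by rewrite -addnn; lia.
by rewrite (star_monic_coef fs) sf//= f0 mul1r.
Qed.

Lemma count_even_star n : count even_star (monics F n.*2) = (#|F| ^ n)%N.
Proof.
rewrite -card_tuple cardT -(size_map (@palindrome n)) -size_filter.
apply/perm_size/uniq_perm.
- by rewrite filter_uniq// monics_uniq.
- by rewrite map_inj_uniq ?enum_uniq//; apply: palindrome_inj.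
move=> f; rewrite mem_filter monicsE; apply/andP/mapP => [[fE fn]|[u _ ->]].
  by have [u ->] := palindrome_surj fn fE; exists u; rewrite ?mem_enum.
by rewrite palindrome_even_star palindrome_monic.
Qed.

End Star.

(** * Reduction of star-symmetric polynomials to even degree *)

Section EvenStarSystem.
Variable F : finFieldType.
Implicit Types (f g : {poly F}) (a : F) (n k : nat).

Let M := [pred f : {poly F} | even_star f].
Let vals : {set F} := [set 1].
Let q := #|F|.

Let M_size f : M f -> (2 %| (size f).-1)%N.
Proof. by case/and3P => _ ev _; rewrite dvdn2. Qed.

Let card_count n c : (0 < n)%N -> c \in vals ->
  (1 * count (fun f => M f && (1 == c)%R) (monics F (2 * n)) = q ^ n)%N.
Proof.
move=> _; rewrite inE => /eqP->; rewrite mul1n mul2n -count_even_star.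
by apply: eq_count => f /=; rewrite eqxx andbT.
Qed.

Let chi_vals f : M f -> (1 : F) \in vals. Proof. by move=> _; apply: set11. Qed.

Let chiM f g : M f -> M g -> (1 : F) = 1 * 1. Proof. by rewrite mulr1. Qed.

Let vals_neq0 c : c \in vals -> c != 0.
Proof. by rewrite inE => /eqP->; rewrite oner_neq0. Qed.

Let vals_div b c : b \in vals -> c \in vals -> c / b \in vals.
Proof. by rewrite !inE => /eqP-> /eqP->; rewrite divr1. Qed.

Let q_gt1 : (1 < q)%N. Proof. exact: finNzRing_gt1. Qed.

Let card_vals_ge : (1 * q <= #|vals| * q + 1)%N.
Proof. by rewrite cards1 leq_addr. Qed.

Let card_vals_le : (#|vals| * q <= 1 * q + 1)%N.
Proof. by rewrite cards1 leq_addr. Qed.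

Definition even_star_system : factor_system F :=
  poly_system (w := 2) (M := M) (chi := fun=> 1) (rt := 1) isT
    (@even_star_monic F) (even_star1 F)
    (@even_starM F) (@even_star_div F) (@even_star_common F) M_size
    chi_vals chiM vals_neq0 vals_div q_gt1 isT (ltnW q_gt1) card_count
    card_vals_ge card_vals_le.

Local Notation elems := (elems even_star_system).

Lemma mem_even_star_elems n f :
  (f \in elems n) = even_star f && monic_of_degree n.*2 f.
Proof. by rewrite mem_filter monicsE mul2n. Qed.

Lemma size_even_star_elems n : size (elems n) = (q ^ n)%N.
Proof. by rewrite size_filter mul2n count_even_star. Qed.

Lemma size_monic f : f \is monic -> size f = (size f).-1.+1.
Proof. by move=> fm; rewrite prednK// size_poly_gt0 monic_neq0. Qed.

Lemma reduced_degree o a n g : odd n = o ->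
  monic_of_degree n (odd_part o a * g) -> g \is monic ->
  (size g).-1 = (n - odd_part_deg o a)%N /\ (odd_part_deg o a <= n)%N.
Proof.
move=> no /andP[lgm /eqP slg] gm.
have lm : odd_part o a \is monic by rewrite -(monicMr _ gm).
have := size_monicM_pred lm gm; rewrite slg size_odd_part /= => ->.
by rewrite addKn leq_addr.
Qed.

Lemma odd_part_deg_half n a : (odd_part_deg (odd n) a <= n)%N ->
  (n - odd_part_deg (odd n) a = ((n - odd_part_deg (odd n) a)./2).*2)%N.
Proof.
move=> ln; rewrite -[LHS]odd_double_half oddB// odd_odd_part_deg addbb add0n.
by [].
Qed.

Definition reduced_half n a := ((n - odd_part_deg (odd n) a)./2).

Lemma star_decomposition_elems n f : monic_of_degree n f -> star_symmetric f ->
  exists2 g, g \in elems (reduced_half n f`_0) &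
    f = odd_part (odd n) f`_0 * g.
Proof.
move=> fn; rewrite star_symmetricE => fs.
have fd : dual_monic 1 f by rewrite /dual_monic fs; case/andP: fn => ->.
have sf : (size f).-1 = n by case/andP: fn => _ /eqP->.
have [g gE fE] := star_monic_decomposition fd; rewrite sf in fE.
exists g => //; rewrite mem_even_star_elems gE/=.
have gm := even_star_monic gE.
have [sg ln] := reduced_degree (erefl _) (etrans (congr1 _ (esym fE)) fn) gm.
by rewrite /monic_of_degree gm size_monic// sg /reduced_half -odd_part_deg_half ?eqxx.
Qed.

Lemma odd_part_mul_inj o a : injective (fun g => odd_part o a * g).
Proof.
move=> g h /mulfI; apply; rewrite -size_poly_gt0 size_odd_part//.
Qed.

Lemma card_PolStar_ge n a : a ^+ 2 = 1 -> (2 <= n)%N ->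
  (q ^ reduced_half n a <= #|PolStar a n|)%N.
Proof.
move=> a2 n2; rewrite -size_even_star_elems.
apply: (card_npoly_ge (h := fun g => odd_part (odd n) a * g)).
- exact: elems_uniq.
- exact: odd_part_mul_inj.
move=> g; rewrite mem_even_star_elems => /andP[gE /andP[gm /eqP sg]].
have ls := odd_part_star (odd n) a2; have lm := dual_monic_monic ls.
have gs := even_star_star gE.
have ln : (odd_part_deg (odd n) a <= n)%N.
  by rewrite (leq_trans _ n2)// /odd_part_deg; case: odd => //; case: eqP.
have fn : monic_of_degree n (odd_part (odd n) a * g).
  rewrite /monic_of_degree monicMl// gm/= size_monic ?monicMl//.
  rewrite size_monicM_pred// size_odd_part sg/= -odd_part_deg_half//.
  by rewrite subnKC.
have fd : dual_monic 1 (odd_part (odd n) a * g).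
  exact: (dual_monicM (one_pchar F)).
have sz : odd_part (odd n) a * g \is a poly_of_size n.+1.
  by rewrite qualifE/=; case/andP: fn => _ /eqP->.
exists (NPoly sz) => //; rewrite !inE fn star_symmetricE /=.
case/and3P: gE => _ _ /eqP g0.
rewrite horner_coef0 coef0M odd_part_coef0// g0 mulr1 eqxx/=.
by case/andP: fd.
Qed.

(** Both f and its factor h are divided by their odd parts. The even part h0
    of h divides the even part of f because f and f / h0 have the same odd
    part; the half degree of h0 is k/2 or k/2 - 1. *)
Lemma HStar_le_count_multiples n k a : a ^+ 2 = 1 ->
  (HStar a n k <= count_multiples even_star_system 1%R (reduced_half n a) k./2 +
     count_multiples even_star_system 1%R (reduced_half n a) k./2.-1)%N.
Proof.
move=> a2; set E := elems (reduced_half n a).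
set has_factor := fun i f => has (fun g => (g %| f)%R) (elems i).
have cmE j : count_multiples even_star_system 1%R (reduced_half n a) j =
    count (has_factor j) E.
  by apply: eq_count => f; rewrite /= eqxx.
rewrite !cmE -count_predUI (leq_trans _ (leq_addr _ _))// -size_filter.
set l := odd_part (odd n) a.
have l_neq0 : l != 0 by rewrite -size_poly_gt0 size_odd_part.
have fE (f : {poly_n.+1 F}) : f \in PolStar a n ->
    exists2 g, g \in E & val f = l * g.
  rewrite !inE horner_coef0 => /andP[/andP[fn /eqP fa] fs].
  by have := star_decomposition_elems fn fs; rewrite fa.
apply: (card_npoly_le (h := fun f => f %/ l)) => [f f'|f].
  move=> /setIdP[/fE[g _ fg] _] /setIdP[/fE[g' _ fg'] _] /=.
  rewrite fg fg' !mulKp// => gg'; apply: val_inj.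
  by rewrite /= fg fg' gg'.
move=> /setIdP[fA /existsP[h /and3P[hk hs hf]]].
have [g gE fg] := fE f fA; rewrite fg mulKp// mem_filter gE andbT.
have [h0 h0E hh] := star_decomposition_elems hk hs.
have h0f : h0 %| val f by apply: dvdp_trans hf; rewrite hh dvdp_mull.
have gS : even_star g by move: gE; rewrite mem_even_star_elems => /andP[].
have h0S : even_star h0 by move: h0E; rewrite mem_even_star_elems => /andP[].
(* the cofactor of h0 in f has the parity and the constant coefficient of f *)
have h0g : h0 %| g.
  have /dvdpP[w fw] := h0f; rewrite mulrC in fw.
  have fd : dual_monic 1 (val f).
    rewrite fg; apply: (dual_monicM (one_pchar F)); first exact: odd_part_star.
    exact: even_star_star.
  have wd : dual_monic 1 w.
    by apply: (dual_monic_div (one_pchar F) (even_star_star h0S)); rewrite -fw.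
  have w0 : w`_0 = a.
    have : (val f)`_0 = a.
      by rewrite fg coef0M odd_part_coef0//; case/and3P: gS => _ _ /eqP->;
         rewrite mulr1.
    by rewrite fw coef0M; case/and3P: h0S => _ _ /eqP->; rewrite mul1r.
  have sf : (size (val f)).-1 = n.
    by move: fA; rewrite !inE => /andP[/andP[/andP[_ /eqP->]]].
  have wn : odd (size w).-1 = odd n.
    rewrite -sf fw (size_monicM_pred (even_star_monic h0S) (dual_monic_monic wd)).
    by rewrite oddD; case/and3P: h0S => _ /negPf->.
  have [w' _ ww'] := star_monic_decomposition wd.
  have : l * g = l * (h0 * w') by rewrite -fg fw ww' w0 wn mulrCA.
  by move/(mulfI l_neq0) ->; rewrite dvdp_mulr.
have : reduced_half k (val h)`_0 = k./2 \/ reduced_half k (val h)`_0 = k./2.-1.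
  rewrite /reduced_half /odd_part_deg; case: (boolP (odd k)) => ko.
    by left; rewrite -[k in LHS]odd_double_half ko add1n subn1/= doubleK.
  case: eqP => _; first by left; rewrite subn0.
  right; rewrite -[k in LHS]odd_double_half (negPf ko) add0n.
  by case: (k./2) => // i; rewrite doubleS subn2/= doubleK.
move=> [] kE; rewrite kE in h0E; apply/orP; [left|right];
  by apply/hasP; exists h0.
Qed.

End EvenStarSystem.

(** * The three families *)

Section Cases.
Variable R : realType.

Lemma pnat_pchar_dvd_card (F : finFieldType) r : (r %| #|F|)%N ->
  [pchar F].-nat r.
Proof.
move=> rF; have [p p_pr p_char] := finPcharP F.
have : p.-nat #|F|.
  by have := abelem_pgroup (fin_ring_pchar_abelem p_char); rewrite /pgroup cardsT.
move/(pnat_dvd rF); apply: sub_in_pnat => s _.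
by rewrite inE => /eqP->.
Qed.

Lemma card_unit_roots (F : finFieldType) r (U : {group {unit F}}) :
  #|U| = r.+1 -> #|[set x : F | x ^+ r.+1 == 1]| = r.+1 /\
  (forall u, u \in U -> FinRing.uval u \in [set x : F | x ^+ r.+1 == 1]).
Proof.
move=> cardU.
have Uroot u : u \in U -> FinRing.uval u \in [set x : F | x ^+ r.+1 == 1].
  move=> uU; rewrite inE -FinRing.val_unitX -cardU.
  by rewrite expg_cardG// FinRing.val_unit1.
split=> //; apply/eqP; rewrite eqn_leq; apply/andP; split.
  rewrite cardE -ltnS.
  have := @max_poly_roots F ('X^(r.+1) - 1%:P) (enum [set x : F | x ^+ r.+1 == 1]).
  rewrite -size_poly_eq0 size_XnsubC// enum_uniq; apply => //.
  apply/allP => x; rewrite mem_enum inE => /eqP x1.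
  by rewrite rootE !hornerE x1 subrr.
rewrite -[X in (X <= _)%N]cardU -(card_imset (mem U) val_inj).
apply: subset_leq_card; apply/subsetP => _ /imsetP[u uU ->].
exact: Uroot.
Qed.

Lemma H_bound : exists C : R, 0 < C /\
    forall (F : finFieldType) (n k : nat) (a : F),
      (1 <= k)%N -> (2 * k <= n)%N -> a != 0 ->
      (H a n k)%:R <= C * (#|F|%:R ^+ (n - 1) * decay R k).
Proof.
have [C C0 bound] := count_multiples_bound R.
exists C; split=> // F n k a k1 kn a0.
have kkn : (k + k <= n)%N by rewrite addnn -mul2n.
apply: le_trans (_ : (count_multiples (nonzero_constant_system F) a n k)%:R <= _).
  by rewrite ler_nat H_le_count_multiples.
apply: le_trans (bound F _ n k k a k1 (leqnn k) kkn _) _; first by rewrite inE.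
have q0 : (#|F|%:R : R) != 0.
  by rewrite pnatr_eq0 gtn_eqF// ltnW// finNzRing_gt1.
have n0 : (0 < n)%N by rewrite (leq_trans k1)// (leq_trans _ kkn)// leq_addr.
by rewrite subn1 -[n in leLHS]prednK// exprSr mulfK.
Qed.

Lemma HDagger_bound : exists C : R, 0 < C /\
    forall (F : finFieldType) (r : nat) (U : {group {unit F}})
           (n k : nat) (a : {unit F}),
      #|F| = (r ^ 2)%N -> #|U| = r.+1 ->
      (1 <= k)%N -> (2 * k <= n)%N -> a \in U ->
      (HDagger r (val a) n k)%:R
        <= C * (#|F|%:R `^ ((n%:R - 1) / 2) * decay R k).
Proof.
have [C C0 bound] := count_multiples_bound R.
exists C; split=> // F r U n k a cardF cardU k1 kn aU.
have kkn : (k + k <= n)%N by rewrite addnn -mul2n.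
have n0 : (0 < n)%N by rewrite (leq_trans k1)// (leq_trans _ kkn)// leq_addr.
have [card_roots Uroots] := card_unit_roots cardU.
have rp : [pchar F].-nat r.
  by apply: pnat_pchar_dvd_card; rewrite cardF expnS dvdn_mulr.
pose S := dual_monic_system rp cardF card_roots.
apply: le_trans (_ : (count_multiples S (val a) n k)%:R <= _).
  by rewrite ler_nat HDagger_le_count_multiples.
apply: le_trans (bound F S n k k (val a) k1 (leqnn k) kkn (Uroots a aU)) _.
have r0 : (r%:R : R) != 0.
  by rewrite pnatr_eq0 gtn_eqF// ltnW// (r_gt1 cardF).
have -> : (#|F|%:R : R) `^ ((n%:R - 1) / 2) = r%:R ^+ n.-1.
  rewrite cardF natrX -powR_mulrn// -powRrM mulrC divfK ?pnatr_eq0//.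
  by rewrite -powR_mulrn// -subn1 natrB.
by rewrite -[n in leLHS]prednK// exprSr mulfK.
Qed.

(** For k >= 4 the parameter K = k/2 - 1 is at most the half degrees of h0 and
    of its cofactor in both cases of [HStar_le_count_multiples]; k < 4 is
    trivial. *)
Lemma HStar_bound : exists C : R, 0 < C /\
    forall (F : finFieldType) (n k : nat) (a : F),
      (1 <= k)%N -> (2 * k <= n)%N -> a = 1 \/ a = -1 ->
      (HStar a n k)%:R <= C * (#|PolStar a n|%:R * decay R k).
Proof.
have [C C0 bound] := count_multiples_bound R.
have [C' C'0 comparable] := decay_comparable R.
have [b b0 lower] := decay_lower_bound (ln 3%:R : R).
exists (2 * C * C' + b^-1); split.
  by rewrite addr_gt0 ?invr_gt0// !mulr_gt0.
move=> F n k a k1 kn a1.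
have a2 : a ^+ 2 = 1 by case: a1 => ->; rewrite ?sqrrN expr1n.
have CC0 : (0 : R) <= 2 * C * C' by rewrite !mulr_ge0 ?(ltW C0) ?(ltW C'0).
set P := #|PolStar a n|; have dec0 := ltW (decay_gt0 R k1).
have PR0 : 0 <= P%:R :> R by [].
have [k4|k3] := leqP 4 k; last first.
  apply: le_trans (_ : P%:R <= _).
    by rewrite ler_nat subset_leq_card//; apply/subsetP => f /setIdP[].
  rewrite mulrCA -[leLHS]mulr1; apply: ler_wpM2l => //.
  rewrite mulrDl; apply: ler_wpDl; first exact: mulr_ge0.
  rewrite ler_pdivlMl// mulr1.
  by apply: lower => //; rewrite ler_ln ?posrE ?ltr0n// ler_nat.
have n2 : (2 <= n)%N by lia.
pose K := (k./2.-1)%N.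
have k2 : (k = odd k + k./2.*2)%N by rewrite odd_double_half.
have k_le := leq_b1 (odd k).
have K0 : (0 < K)%N by rewrite /K; move: k2 k_le k4; rewrite -addnn; lia.
have Kk : (K <= k)%N by rewrite /K; move: k2; rewrite -addnn; lia.
have kK : (k <= 6 * K)%N by rewrite /K; move: k2 k_le k4; rewrite -addnn; lia.
set N' := reduced_half n a.
have N'_ge : (k <= N'.+1)%N.
  have d2 : (odd_part_deg (odd n) a <= 2)%N.
    by rewrite /odd_part_deg; case: (odd n) => //; case: (a == 1).
  rewrite /N' /reduced_half.
  have : ((n - 2)./2 <= (n - odd_part_deg (odd n) a)./2)%N.
    by rewrite half_leq// leq_sub2l.
  have : (k.-1 <= (n - 2)./2)%N.
    by rewrite -[k.-1]doubleK half_leq// -subn1 doubleB leq_sub2r// -mul2n.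
  by move=> h1 /(leq_trans h1); rewrite -[k in (_ -> (k <= _)%N)]prednK.
have K1 : (k./2 + K <= N')%N by rewrite /K; move: k2 N'_ge; rewrite -addnn; lia.
have PN : (#|F|%:R ^+ N' : R) <= P%:R.
  by rewrite -natrX ler_nat card_PolStar_ge.
apply: le_trans (_ : (count_multiples (even_star_system F) 1 N' k./2 +
     count_multiples (even_star_system F) 1 N' k./2.-1)%:R <= _).
  by rewrite ler_nat HStar_le_count_multiples.
have one_in : (1 : F) \in values (even_star_system F) by rewrite inE.
rewrite natrD.
apply: le_trans (lerD (bound F _ N' k./2 K 1 K0 (leq_pred _) K1 one_in)
  (bound F _ N' k./2.-1 K 1 K0 (leqnn _) _ one_in)) _.
  by rewrite (leq_trans _ K1)// leq_add2r leq_pred.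
rewrite /= divr1.
have PK : #|F|%:R ^+ N' * decay R K <= P%:R * (C' * decay R k).
  apply: ler_pM => //; first by rewrite exprn_ge0.
    by apply/ltW/decay_gt0.
  exact: comparable.
have := ler_wpM2l (ltW C0) PK.
have : 0 <= b^-1 * (P%:R * decay R k).
  by apply: mulr_ge0; [rewrite invr_ge0 ltW|exact: mulr_ge0].
lra.
Qed.

End Cases.

Theorem proposition2p4 (R : realType) :
  (exists C : R, 0 < C /\
    forall (F : finFieldType) (n k : nat) (a : F),
      (1 <= k)%N -> (2 * k <= n)%N -> a != 0 ->
      (H a n k)%:R <= C * (#|F|%:R ^+ (n - 1) * decay R k))
  /\
  (exists C : R, 0 < C /\
    forall (F : finFieldType) (n k : nat) (a : F),
      (1 <= k)%N -> (2 * k <= n)%N -> a = 1 \/ a = -1 ->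
      (HStar a n k)%:R <= C * (#|PolStar a n|%:R * decay R k))
  /\
  (exists C : R, 0 < C /\
    forall (F : finFieldType) (r : nat) (U : {group {unit F}})
           (n k : nat) (a : {unit F}),
      #|F| = (r ^ 2)%N -> #|U| = r.+1 ->
      (1 <= k)%N -> (2 * k <= n)%N -> a \in U ->
      (HDagger r (val a) n k)%:R
        <= C * (#|F|%:R `^ ((n%:R - 1) / 2) * decay R k)).
Proof.
split; first exact: H_bound.
by split; [exact: HStar_bound | exact: HDagger_bound].
Qed.
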